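(* There is a family of smooth functions $\left(U(\underline{\varsigma})\right)_{\underline{\varsigma}\in\{+,-\}^{\mathbb{N}}}$ from $\mathbb{T}$ to $\mathbb{R}$ that is continuous in the $C^\infty$ topology (i.e. $\underline{\varsigma}\mapsto U(\underline{\varsigma})$ is continuous from $\{+,-\}^{\mathbb{N}}$ to $C^\infty(\mathbb{T},\mathbb{R})$), and such that the following property holds. For each integer $m\ge 1$ put $\beta_m = 2^{(m+10)^3}$. Then for every $\underline{\varsigma}=(\varsigma(m))_{m\in\mathbb{N}}$ in $\{+,-\}^{\mathbb{N}}$, every pair of integers $\widehat{m}$ and $m$ satisfying $$\widehat{m}\ge m\ge 1 \quad\text{and}\quad \varsigma(m)=\cdots=\varsigma(\widehat{m}),$$ and every $\beta$ in $[\beta_m,\beta_{\widehat{m}}]$, the unique Gibbs measure $\rho_{\beta\cdot U(\underline{\varsigma})}$ for the interaction $\Phi_{\beta\cdot U(\underline{\varsigma})}$ satisfies $$\rho_{\beta\cdot U(\underline{\varsigma})}\left(\pi^{-1}\left(\left[-2^{-(m+1)^2},2^{-(m+1)^2}\right]\right)\right)\ge 1-2^{-m}$$ if $\varsigma(m)=+$, and $$\rho_{\beta\cdot U(\underline{\varsigma})}\left(\pi^{-1}\left(\left[\tfrac12-2^{-(m+1)^2},\tfrac12+2^{-(m+1)^2}\right]\right)\right)\ge 1-2^{-m}$$ if $\varsigma(m)=-$.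
   Context: $\mathbb{N}=\{1,2,\dots\}$. $\mathbb{T} = \mathbb{R}/\mathbb{Z}$ with its additive group structure and Lebesgue probability measure $\mathrm{Leb}$; intervals of $\mathbb{R}$ are projected to $\mathbb{T}$. $\{+,-\}$ has the discrete topology and $\{+,-\}^{\mathbb{N}}$ the product topology. The projection $\pi\colon\mathbb{T}^{\mathbb{Z}}\to\mathbb{T}$ is $\pi((\theta_n)_{n\in\mathbb{Z}})=\theta_0-\theta_1$. For a function $U \colon \mathbb{T} \to \mathbb{R}$, $\Phi_U$ is the nearest-neighbor interaction on $\mathbb{T}^{\mathbb{Z}}$ given by $\Phi_U(\{k,k+1\})((\theta_n)_{n\in\mathbb{Z}}) = -U(\theta_k - \theta_{k+1})$ for $k \in \mathbb{Z}$, and $\Phi_U(X)=0$ for all other finite $X \subset \mathbb{Z}$. A Gibbs measure for $\Phi_U$ is a Borel probability measure on $\mathbb{T}^{\mathbb{Z}}$ satisfying the DLR equations with a priori measure $\mathrm{Leb}$: for every finite $\Lambda \subset \mathbb{Z}$, conditionally on the configuration $\underline{\theta}'$ outside $\Lambda$, the configuration $\underline{\theta}$ in $\Lambda$ has density $Z_\Lambda(\underline{\theta}')^{-1}\exp(-H_\Lambda(\underline{\theta}|\underline{\theta}'))$ with respect to $\bigotimes_\Lambda \mathrm{Leb}$, where $H_\Lambda(\underline{\theta}|\underline{\theta}') = \sum_{X \text{ finite},\, X\cap\Lambda\neq\emptyset}\Phi_U(X)(\underline{\theta}\times\underline{\theta}')$ and $Z_\Lambda(\underline{\theta}')$ is the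 normalizing constant. When $U$ is continuous there is a unique Gibbs measure for $\Phi_U$, denoted $\rho_U$. *)

(* Defs.v *)
From HB Require Import structures.
From mathcomp Require Import all_boot all_order all_algebra finmap.
From mathcomp Require Import generic_quotient ring_quotient.
From mathcomp Require Import all_classical all_reals all_analysis.
From mathcomp Require Import measurable_realfun zify.

Set Implicit Arguments.
Unset Strict Implicit.
Unset Printing Implicit Defensive.

Import Order.TTheory GRing.Theory Num.Theory.
Import numFieldNormedType.Exports.

Local Open Scope classical_set_scope.
Local Open Scope ring_scope.

Section circle.
Variable R : realType.

Definition int_subgroup : zmodClosed R :=
  GRing.ZmodClosed.clone R (@Num.int_num_subdef R) _.

(* {ideal_quot _} only requires an additive subgroup: this is the group R/Z. *)
Definition R_mod_Z : Type := {ideal_quot int_subgroup}.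
HB.instance Definition _ := GRing.Zmodule.on R_mod_Z.
HB.instance Definition _ := EqQuotient.on R_mod_Z.

(* The measurable sets are the Borel sets of the quotient topology. *)
Definition circle : Type := quotient_topology R_mod_Z.
HB.instance Definition _ := Quotient.on circle.
HB.instance Definition _ := Topological.on circle.
HB.instance Definition _ := Pointed.on circle.
HB.instance Definition _ := GRing.Zmodule.copy circle R_mod_Z.
HB.instance Definition _ :=
  Measurable.copy circle (g_sigma_algebraType (@open circle)).

Definition to_circle : R -> circle := (\pi_circle)%qT.

Lemma to_circleB : {morph to_circle : x y / x - y}.
Proof.
move=> x y; rewrite /to_circle.
have piD := @Quotient.pi_add R int_subgroup.
have piN := @Quotient.pi_opp R int_subgroup.
by rewrite piD piN.
Qed.

Lemma to_circle_eq (x y : R) :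
  to_circle x = to_circle y <-> x - y \is a Num.int.
Proof.
have piE := @Quotient.idealrBE R int_subgroup x y.
split=> [xy|xy].
  have : x - y \in int_subgroup by rewrite piE; apply/eqP; exact: xy.
  by [].
have {}xy : x - y \in int_subgroup by exact: xy.
by move: xy; rewrite piE => /eqP.
Qed.

Lemma measurable_to_circle : measurable_fun [set: measurableTypeR R]
  (to_circle : measurableTypeR R -> circle).
Proof.
apply: (@measurability _ _ _ _ _ _ (@open circle)) => // _ [A oA <-].
rewrite setTI; apply: open_measurable.
exact: oA.
Qed.

Definition circle_leb : set circle -> \bar R :=
  pushforward (mrestr lebesgue_measure (measurable_itv `[0 : R, 1[)) to_circle.

Let circle_leb0 : circle_leb set0 = 0%E.
Proof. by rewrite /circle_leb /pushforward preimage_set0 measure0. Qed.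

Let circle_leb_ge0 A : (0 <= circle_leb A)%E.
Proof. by rewrite /circle_leb /pushforward; exact: measure_ge0. Qed.

Let circle_leb_sigma_additive : semi_sigma_additive circle_leb.
Proof.
move=> F mF tF mUF; rewrite /circle_leb /pushforward preimage_bigcup.
have mpre A : measurable A -> measurable (to_circle @^-1` A).
  by move=> mA; rewrite -[X in measurable X]setTI; exact: measurable_to_circle.
apply: measure_semi_sigma_additive.
- by move=> n; exact: mpre.
- apply/trivIsetP => /= i j _ _ ij; rewrite -preimage_setI.
  by move/trivIsetP : tF => /(_ _ _ _ _ ij) ->//; rewrite preimage_set0.
- by rewrite -preimage_bigcup; exact: mpre.
Qed.

HB.instance Definition _ := isMeasure.Build _ _ _ circle_leb
  circle_leb0 circle_leb_ge0 circle_leb_sigma_additive.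

Let circle_leb_setT : circle_leb setT = 1%E.
Proof.
rewrite /circle_leb /pushforward /mrestr preimage_setT setTI.
by rewrite lebesgue_measure_itv /= lte01 oppr0 adde0.
Qed.

HB.instance Definition _ := Measure_isProbability.Build _ _ _ circle_leb
  circle_leb_setT.

End circle.

Section smooth.
Variable R : realType.

Definition circle_lift (f : circle R -> R) : R -> R := f \o @to_circle R.

Definition smooth (f : circle R -> R) : Prop :=
  forall (k : nat) (x : R), derivable (derive1n k (circle_lift f)) x 1.

Record Cinfty := { Cinfty_fun :> circle R -> R ; _ : smooth Cinfty_fun }.

HB.instance Definition _ := gen_eqMixin Cinfty.
HB.instance Definition _ := gen_choiceMixin Cinfty.

(* The sequence of all derivatives, each one in the topology of uniform
   convergence: the initial topology of [jet] is the C^oo topology. *)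
Definition jet (f : Cinfty) : prod_topology (fun _ : nat => {uniform R -> R}) :=
  fun k => derive1n k (circle_lift f).

HB.instance Definition _ := Topological.copy Cinfty (initial_topology jet).

End smooth.

Section gibbs.
Variable R : realType.
Local Notation T := (circle R).

(* The measurable sets are the Borel sets of the product topology. *)
Definition config : Type := prod_topology (fun _ : int => T).
HB.instance Definition _ := Topological.on config.
HB.instance Definition _ := Pointed.on config.
HB.instance Definition _ :=
  Measurable.copy config (g_sigma_algebraType (@open config)).

Definition interaction := {fset int} -> config -> R.

(* The sum has exactly one term if X is of the form {k, k+1}, none otherwise. *)
Definition nn_interaction (U : T -> R) : interaction := fun X w =>
  \sum_(k \in [set k : int | X = [fset k; (k + 1)%R]%fset])
    - U (w k - w (k + 1)).

Lemma nn_interaction_pair (U : T -> R) (k : int) (w : config) :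
  nn_interaction U [fset k; (k + 1)%R]%fset w = - U (w k - w (k + 1)).
Proof.
rewrite /nn_interaction (_ : [set _ | _] = [set k]) ?fsbig_set1//.
apply/seteqP; split=> [j /= /fsetP E|j /= ->]//.
have := E j; have := E (j + 1); have := E k; rewrite !inE !eqxx /= ?orbT.
case: (eqVneq j k) => // jk; lia.
Qed.

Lemma nn_interaction_other (U : T -> R) (X : {fset int}) (w : config) :
  (forall k : int, X <> [fset k; (k + 1)%R]%fset) -> nn_interaction U X w = 0.
Proof.
move=> XN; rewrite /nn_interaction (_ : [set _ | _] = set0) ?fsbig_set0//.
by apply/seteqP; split=> [j /XN|].
Qed.

(* A sum over infinitely many sets X, only finitely many of which contribute
   for an interaction of finite range. *)
Definition hamiltonian (Phi : interaction) (L : {fset int}) (w : config) : R :=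
  \sum_(X \in [set X : {fset int} | (X `&` L)%fset != fset0]) Phi X w.

(* Integral of f over the coordinates in s (listed without repetition), with
   respect to the product of copies of the Lebesgue measure, the other
   coordinates being those of w. The product measure is spelled out as an
   iterated integral. *)
Fixpoint integral_sites (s : seq int) (f : config -> \bar R) (w : config)
    : \bar R :=
  if s is k :: s' then
    (\int[@circle_leb R]_x integral_sites s' f (dfwith w k x))%E
  else f w.

Definition partition_function (Phi : interaction) (L : {fset int})
    (w : config) : \bar R :=
  integral_sites L (fun t => (expR (- hamiltonian Phi L t))%:E) w.

Definition gibbs_kernel (Phi : interaction) (L : {fset int}) (w : config)
    (A : set config) : \bar R :=
  integral_sites L (fun t =>
    (\1_A t * ((fine (partition_function Phi L w))^-1 *
               expR (- hamiltonian Phi L t)))%:E) w.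

Definition outside_sigma_algebra (L : {fset int}) : set (set config) :=
  <<s \bigcup_(k in [set k : int | k \notin L])
        preimage_set_system setT (fun w : config => w k) measurable >>.

(* DLR equations: gibbs_kernel Phi L is a version of the conditional law given
   the configuration outside L. *)
Definition gibbs_measure (Phi : interaction) (mu : probability config R) :=
  forall (L : {fset int}) (A B : set config),
    measurable A -> outside_sigma_algebra L B ->
    mu (A `&` B) = (\int[mu]_(w in B) gibbs_kernel Phi L w A)%E.

Definition difference (w : config) : T := w 0 - w 1.

End gibbs.

(* A point of cantor_space is a sequence indexed by nat, whereas sign sequences
   are indexed by the positive integers: the m-th sign is the (m - 1)-st term.
   Only m >= 1 is meaningful. *)
Definition plus : bool := true.
Definition minus : bool := false.
Definition sign (s : cantor_space) (m : nat) : bool := s m.-1.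

Definition beta (R : realType) (m : nat) : R := 2 ^+ ((m + 10) ^ 3).

(* Main.v *)
Require Import Defs.
From HB Require Import structures.
From mathcomp Require Import all_boot all_order all_algebra finmap.
From mathcomp Require Import all_classical all_reals all_analysis.
From mathcomp Require Import measurable_realfun lra zify ring.

(* The increments of a Gibbs measure for [nn_interaction U] have density
   exp U / int exp U: dividing the measure by the weights of the bonds 0, ..., n
   gives a measure that is invariant under resampling any of the sites 1, ..., n,
   so that the law of w 0 - w 1 is the density exp U reweighted by an n-fold
   convolution power of it, and this power flattens geometrically in n because
   exp U is bounded below.

   U(s) is a sum over the scales m of two smooth bumps of common height
   e_m = 2^-((m+10)^3-(m+10)), one at 0 and one at 1/2. The bump at the site
   preferred by the m-th sign has width d_m = 2^-(m+1)^2, the other one is narrower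
   by a factor 2^-(m+3); since e_m decays faster than any power of the widths, the
   series converges in the smooth topology. The preference is thus purely entropic.
   If the signs m, ..., m' are + and beta lies between beta_m and beta_m', then
   beta e_m is so large that almost all the mass of exp(beta U) lies in the bumps of
   scale m, the bumps of scales beyond m' change exp(beta U) by a bounded factor
   only, and the dilation by 2^(m+3) compares the profile around 1/2 to the one
   around 0, at the cost of a factor 2^-(m+3) for the mass. *)

Set Implicit Arguments.
Unset Strict Implicit.
Unset Printing Implicit Defensive.

Import Order.TTheory GRing.Theory Num.Theory.
Import numFieldNormedType.Exports.

Local Open Scope classical_set_scope.
Local Open Scope ring_scope.

(** * Lebesgue measure on the circle *)

(** The constants answer three demands. Since beta_m e_m = 2^(m+10), the gain exp(beta e_m) on a
    bump outweighs the smallness 2^-(m+1)^2 of its width. Since the exponents of the heights grow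
    cubically, beta_m' times the sum of all heights beyond m' is at most 1/2. Since the exponents of
    the widths grow quadratically, every earlier bump at the preferred site, even a narrow one, is
    at full height on the whole wide bump of scale m; earlier scales thus add there the most that
    they can add anywhere, and past signs leave no trace. Inside a block of equal signs the heights
    at 0 and 1/2 tie at every temperature, so that one dilation settles all beta at once.
    Translation invariance of the Gibbs measure is not assumed. One-site DLR equations yield an
    upper bound for the law of an increment, which suffices because it is applied to the complement
    of the preferred arc. The bumps are functions of the squared sine or cosine of pi t, hence
    periodic without gluing; the price is that concavity of the sine replaces exact scaling. *)

Lemma lebesgue_measure_affine (R : realType) (c a : R)
    (A : set (measurableTypeR R)) : c != 0 -> measurable A ->
  lebesgue_measure A =
  (`|c|%:E * lebesgue_measure ((fun t : R => (c * t + a)%R) @^-1` A))%E.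
Proof.
move=> c0 mA.
pose f (t : measurableTypeR R) : measurableTypeR R := c * t + a.
have mf : measurable_fun [set: measurableTypeR R] f.
  exact/measurable_funD/measurable_cst/measurable_funM.
pose mfi := isMeasurableFun.Build _ _ _ _ f mf.
pose F : {mfun measurableTypeR R >-> measurableTypeR R} := HB.pack f mfi.
have nc : 0 <= `|c| by [].
(* Uniqueness reduces the identity to half-open intervals; for negative [c] the preimage is open at
   the other end, hence the two cases. *)
have := @lebesgue_measure_unique R
  (mscale (NngNum nc) (pushforward lebesgue_measure F)).
apply => //; move=> _ [[x y] _ <-] /=.
rewrite /mscale /= /pushforward.
rewrite lebesgue_measure_itv /= lte_fin.
have [cp|cn|] := ltgtP c 0; last by move=> /eqP; rewrite (negbTE c0).
- rewrite (_ : F @^-1` _ = `[((y - a) / c), ((x - a) / c)[%classic); last first.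
    apply/seteqP; split=> t /=; rewrite !in_itv /= /f ler_ndivrMr// ltr_ndivlMr// [t * c]mulrC; lra.
  rewrite lebesgue_measure_itv /= lte_fin ltr_ndivrMr// mulrAC -mulrA mulfV// mulr1 ltrD2r.
  case: ifPn => // _; last by rewrite mule0.
  rewrite -[LHS]/((y - x)%:E) -!EFinD -EFinM; congr EFin; rewrite ltr0_norm//; field.
  by rewrite lt_eqF.
- rewrite (_ : F @^-1` _ = `]((x - a) / c), ((y - a) / c)]%classic); last first.
    apply/seteqP; split=> t /=; rewrite !in_itv /= /f ler_pdivlMr// ltr_pdivrMr// [t * c]mulrC; lra.
  rewrite lebesgue_measure_itv /= lte_fin ltr_pdivlMr// mulrAC -mulrA mulfV// mulr1 ltrD2r.
  case: ifPn => // _; last by rewrite mule0.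
  rewrite -[LHS]/((y - x)%:E) -!EFinD -EFinM; congr EFin; rewrite gtr0_norm//; field.
  by rewrite gt_eqF.
Qed.

Lemma ge0_integral_affine (R : realType) (c a : R) (f : R -> \bar R) :
  c != 0 -> measurable_fun [set: measurableTypeR R] f ->
  (forall t, 0 <= f t)%E ->
  (\int[lebesgue_measure]_t f (c * t + a)%R =
   (`|c|^-1)%:E * \int[lebesgue_measure]_t f t)%E.
Proof.
move=> c0 mf f0.
pose phi (t : measurableTypeR R) : measurableTypeR R := c * t + a.
have mphi : measurable_fun [set: measurableTypeR R] phi.
  exact/measurable_funD/measurable_cst/measurable_funM.
pose mfi := isMeasurableFun.Build _ _ _ _ phi mphi.
pose F : {mfun measurableTypeR R >-> measurableTypeR R} := HB.pack phi mfi.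
have nc : 0 <= `|c|^-1 by rewrite invr_ge0.
rewrite -[LHS](@ge0_integral_pushforward _ _ _ _ R _ mphi lebesgue_measure setT)//.
rewrite -(@ge0_integral_mscale _ _ _ lebesgue_measure _ measurableT (NngNum nc) f)//.
apply: (@eq_measure_integral _ _ _ _ (mscale (NngNum nc) lebesgue_measure)
  (pushforward lebesgue_measure F)) => A mA _.
have : ((`|c|^-1)%:E * lebesgue_measure A = lebesgue_measure (phi @^-1` A))%E.
  by rewrite (lebesgue_measure_affine a c0 mA) muleA -EFinM mulVf ?mul1e ?normr_eq0.
by move=> /esym.
Qed.

Section circle_section.
Variable R : realType.
Local Notation T := (circle R).
Local Notation to_circle := (@to_circle R).

(** The section of the quotient map with values in [0, 1). Being Borel, it transports measurability
    questions from the circle to the line. *)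
Definition csec (x : T) : R := let r : R := repr x in r - (Num.floor r)%:~R.

Lemma to_circleDz (t : R) (n : int) : to_circle (t + n%:~R) = to_circle t.
Proof. by apply/to_circle_eq; rewrite addrAC subrr add0r intr_int. Qed.

Lemma csecK x : to_circle (csec x) = x.
Proof.
rewrite /csec /= -mulrNz to_circleDz /to_circle; exact: reprK.
Qed.

Lemma csec_itv x : csec x \in `[0, 1[.
Proof.
rewrite in_itv /= /csec; set r : R := repr x.
by rewrite subr_ge0 floor_le_tmp ltrBlDl -[X in _ + X]/(1%:~R) -intrD1 floorD1_gt.
Qed.

Lemma to_circleK t : t \in `[0, 1[ -> csec (to_circle t) = t.
Proof.
rewrite in_itv /= => /andP[t0 t1].
have /to_circle_eq /intrP[n] := csecK (to_circle t).
have := csec_itv (to_circle t); rewrite in_itv /= => /andP[s0 s1] st.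
suff n0 : n = 0 by apply/eqP; rewrite -subr_eq0 st n0.
have : (-1 < n%:~R :> R) by rewrite -st; lra.
have : (n%:~R < 1 :> R) by rewrite -st; lra.
have -> : (-1 : R) = (-1)%:~R by rewrite mulrNz.
rewrite -[X in _ < X -> _]/(1%:~R) !ltr_int; lia.
Qed.

Lemma preimage_to_circle_image (A : set R) :
  to_circle @^-1` (to_circle @` A) = \bigcup_(n : int) ((fun t => t + n%:~R) @^-1` A).
Proof.
apply/seteqP; split=> [t [a Aa /to_circle_eq /intrP[n an]]|t [n _ /= An]].
  by exists n => //=; rewrite -an addrC subrK.
by exists (t + n%:~R) => //; exact: to_circleDz.
Qed.

Lemma open_to_circle (A : set R) : open A -> open (to_circle @` A).
Proof.
move=> oA.
suff : open (to_circle @^-1` (to_circle @` A)) by [].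
rewrite preimage_to_circle_image; apply: bigcup_open => n _.
apply: open_comp => // t _.
by apply: (@continuousD _ R^o); [exact: cvg_id|exact: cvg_cst].
Qed.

Lemma measurable_to_circle_oo (a b : R) : measurable (to_circle @` `]a, b[).
Proof. by apply: sub_sigma_algebra; exact/open_to_circle/itv_open. Qed.

(** The section jumps only at the class of 0. For [a] in ]0, 1[ the preimage of []-oo, a[] is this
    point, written as the complement of the image of []0, 1[], together with the open image of []0,
    a[]. *)
Lemma measurable_csec : measurable_fun [set: T] (csec : T -> measurableTypeR R).
Proof.
have cE (S : set R) : S `<=` `[0, 1[ -> to_circle @` S = csec @^-1` S.
  move=> S01; apply/seteqP; split=> [_ [t St <-]/=|x Sx].
    by rewrite to_circleK //; exact: S01.
  by exists (csec x) => //; exact: csecK.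
have mlt a : measurable (csec @^-1` `]-oo, a[ : set T).
  have [a0|a0] := leP a 0.
    rewrite (_ : _ @^-1` _ = set0)//; apply/seteqP; split=> x //=.
    by have := csec_itv x; rewrite !in_itv /=; lra.
  have [a1|a1] := leP 1 a.
    rewrite (_ : _ @^-1` _ = setT)//; apply/seteqP; split=> x //= _.
    by have := csec_itv x; rewrite !in_itv /=; lra.
  rewrite (_ : _ @^-1` _ =
    ~` (to_circle @` `]0, 1[) `|` to_circle @` `]0, a[); last first.
    rewrite !cE; last 2 first.
    - by move=> t /=; rewrite !in_itv /=; lra.
    - by move=> t /=; rewrite !in_itv /=; lra.
    apply/seteqP; split=> x /=; have := csec_itv x; rewrite !in_itv /=.
      move=> /andP[s0 s1] sa; have [->|s0'] := eqVneq (csec x) 0; first by left; rewrite ltxx.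
      by right; rewrite sa andbT lt_def s0' s0.
    move=> /andP[s0 s1] [/negP|/andP[]//]; rewrite s1 andbT -leNgt => s0'.
    exact: le_lt_trans a0.
  by apply: measurableU; [apply: measurableC|]; exact: measurable_to_circle_oo.
apply: (@measurability _ _ _ (measurableTypeR R) _ _ (@RGenInftyO.G R)).
  by rewrite RGenInftyO.measurableE.
by move=> _ [_ [a ->] <-]; rewrite setTI; exact: mlt.
Qed.

Lemma measurable_circleB d (X : measurableType d) (f g : X -> T) :
  measurable_fun setT f -> measurable_fun setT g ->
  measurable_fun setT (fun x => f x - g x).
Proof.
move=> mf mg.
rewrite (_ : (fun _ => _) = to_circle \o (fun x => csec (f x) - csec (g x))).
  apply: measurableT_comp; first exact: measurable_to_circle.
  by apply: measurable_funB; apply: measurableT_comp => //; exact: measurable_csec.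
by apply/funext => x /=; rewrite to_circleB !csecK.
Qed.

Lemma ge0_integral_circle (f : T -> \bar R) : measurable_fun setT f ->
  (forall x, 0 <= f x)%E ->
  (\int[@circle_leb R]_x f x =
   \int[lebesgue_measure]_(t in `[0%R, 1%R[) f (to_circle t))%E.
Proof.
move=> mf f0.
pose m01 := mrestr (@lebesgue_measure R) (measurable_itv `[0 : R, 1[).
rewrite /circle_leb -/m01 (@ge0_integral_pushforward _ _ _ _ R _ (@measurable_to_circle R) m01)//.
rewrite preimage_setT.
have mft : measurable_fun setT (f \o to_circle : measurableTypeR R -> \bar R).
  by apply: measurableT_comp => //; exact: measurable_to_circle.
rewrite (@ge0_negligible_integral _ _ _ m01 setT (~` `[0%R, 1%R[))//=.
- rewrite setTD setCK; apply: eq_measure_integral => A mA A01.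
  by rewrite /m01 /= /mrestr setIidl.
- exact: measurableC.
- by rewrite /m01 /= /mrestr setICl measure0.
Qed.

(** The reflection about [a] carries [[0, 1[] to []a - 1, a]], whose negative part is brought back
    to []a, 1[] by an integer translation. Reflections are the symmetry that occurs throughout: in
    the increments [w 0 - x], in the convolutions [p (y - x)], and in the exchange of 0 and 1/2. *)
Lemma circle_leb_reflection (y : T) (A : set T) : measurable A ->
  @circle_leb R ((fun x => y - x) @^-1` A) = @circle_leb R A.
Proof.
move=> mA; set P : set (measurableTypeR R) := to_circle @^-1` A.
have mP : measurable P.
  by rewrite -[P]setTI; exact: measurable_to_circle.
set a := csec y.
have /andP[a0 a1] : 0 <= a < 1 by have := csec_itv y; rewrite in_itv.
have Pz (t : R) (n : int) : P (t + n%:~R) = P t by rewrite /P /preimage/= to_circleDz.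
have EA (B : set T) : circle_leb B =
  lebesgue_measure ((to_circle @^-1` B) `&` `[0%R, 1%R[) by [].
rewrite !EA.
have lebI (n d : R) (B : set (measurableTypeR R)) : n ^+ 2 = 1 -> measurable B ->
    lebesgue_measure B = lebesgue_measure ((fun t : R => n * t + d) @^-1` B).
  move=> n1 mB; rewrite (@lebesgue_measure_affine _ n d)//.
    suff -> : `|n| = 1 by rewrite mul1e.
    by apply/eqP; rewrite -[_ == _](@eqrXn2 _ 2%N)// expr1n -normrX n1 normr1.
  by apply: contra_eq_neq n1 => ->; rewrite expr0n /= eq_sym oner_neq0.
transitivity (lebesgue_measure (P `&` `](a - 1)%R, a])).
  rewrite [RHS](lebI (-1) a); last 2 first.
  - by rewrite sqrrN expr1n.
  - exact: measurableI.
  congr (lebesgue_measure _); rewrite preimage_setI; congr (_ `&` _).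
    apply/funext => t; rewrite /P /preimage /mkset.
    by rewrite mulN1r [- t + a]addrC to_circleB csecK.
  by apply/seteqP; split=> t /=; rewrite !in_itv /=; lra.
have -> : `](a - 1)%R, a]%classic = `](a - 1)%R, 0%R[ `|` `[0%R, a] :> set R.
  by apply/seteqP; split=> t /=; rewrite !in_itv /=; case: (ltP t 0) => ? /=; lra.
have -> : `[0%R, 1%R[%classic = `[0%R, a] `|` `]a, 1[ :> set R.
  by apply/seteqP; split=> t /=; rewrite !in_itv /=; case: (leP t a) => ? /=; lra.
rewrite !setIUr !measureU//=; last 6 first.
- exact: measurableI.
- exact: measurableI.
- by apply/seteqP; split=> t //= [[_ +] [_ +]]; rewrite !in_itv /=; lra.
- exact: measurableI.
- exact: measurableI.
- by apply/seteqP; split=> t //= [[_ +] [_ +]]; rewrite !in_itv /=; lra.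
rewrite addeC; congr (_ + _)%E.
rewrite (lebI 1 (-1)); last 2 first.
- by rewrite expr1n.
- exact: measurableI.
congr (lebesgue_measure _); rewrite preimage_setI; congr (_ `&` _).
  by apply/funext => t; rewrite /preimage /= mul1r -[-1]/((-1)%:~R) Pz.
by apply/seteqP; split=> t /=; rewrite !in_itv /=; lra.
Qed.

End circle_section.

(** * Resampling one coordinate *)

Lemma ge0_integral_circle_reflection (R : realType) (y : circle R)
    (f : circle R -> \bar R) : measurable_fun setT f ->
  (forall x, 0 <= f x)%E ->
  (\int[@circle_leb R]_x f (y - x)%R = \int[@circle_leb R]_x f x)%E.
Proof.
move=> mf f0.
have mB : measurable_fun [set: circle R] (fun x => y - x).
  by apply: measurable_circleB => //; exact: measurable_cst.
rewrite -[LHS](@ge0_integral_pushforward _ _ _ _ R _ mB (@circle_leb R) setT)//.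
pose mBi := isMeasurableFun.Build _ _ _ _ _ mB.
pose F : {mfun circle R >-> circle R} := HB.pack (fun x : circle R => y - x) mBi.
apply: (@eq_measure_integral _ _ _ _ (@circle_leb R) (pushforward (@circle_leb R) F)) => A mA _.
exact: circle_leb_reflection.
Qed.

Lemma integral_circle_cst (R : realType) (r : \bar R) :
  (\int[@circle_leb R]_x r = r)%E.
Proof.
rewrite integral_cst//= (_ : circle_leb _ = 1%E) ?mule1//.
exact: probability_setT.
Qed.

Lemma measurable_funV_gt0 d (X : measurableType d) (R : realType) (f : X -> R) :
  measurable_fun setT f -> (forall x, 0 < f x) ->
  measurable_fun setT (fun x => (f x)^-1).
Proof.
move=> mf f0; under eq_fun => x do rewrite -powR_inv1 ?ltW//.
exact: (measurableT_comp (@measurable_powR R (-1)) mf).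
Qed.

(** * Integration against the image of a measure with density *)

Section integral_image_density.
Context d d' (X : measurableType d) (Y : measurableType d') (R : realType).
Variables (nu : {measure set X -> \bar R}) (m : {measure set Y -> \bar R}).
Variables (phi : Y -> X) (h : Y -> R).
Hypotheses (mphi : measurable_fun setT phi) (mh : measurable_fun setT h).
Hypotheses (h0 : forall y, 0 <= h y).
Hypothesis nuE : forall A, measurable A ->
  nu A = (\int[m]_y (\1_A (phi y) * h y)%:E)%E.
Local Open Scope ereal_scope.

Import HBNNSimple.

(** Simple functions and monotone convergence. It serves to extend the DLR equations from sets to
    nonnegative functions: there [m] is the product of [nu] with Lebesgue measure and [phi] updates
    one coordinate. *)
Lemma ge0_integral_image_density (g : X -> \bar R) : measurable_fun setT g ->
  (forall x, 0 <= g x) ->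
  \int[nu]_x g x = \int[m]_y (g (phi y) * (h y)%:E).
Proof.
move=> mg g0; pose g_ := nnsfun_approx measurableT mg.
have mgphi n : measurable_fun setT (fun y => (g_ n (phi y) * h y)%:E).
  by apply/measurable_EFinP/measurable_funM => //; apply: measurableT_comp.
transitivity (limn (fun n => \int[nu]_x (g_ n x)%:E)).
  rewrite -monotone_convergence//.
  - by apply: eq_integral => x _; apply/esym/cvg_lim => //; exact: cvg_nnsfun_approx.
  - by move=> n; exact/measurable_EFinP/measurable_funP.
  - by move=> n x _; rewrite lee_fin.
  - by move=> x _ a b ab; rewrite lee_fin; exact/lefP/nd_nnsfun_approx.
transitivity (limn (fun n => \int[m]_y (g_ n (phi y) * h y)%:E)); last first.
  rewrite -monotone_convergence//.
  - apply: eq_integral => y _; apply/cvg_lim => //.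
    under eq_fun do rewrite EFinM.
    apply: cvgeZr => //; exact: cvg_nnsfun_approx.
  - by move=> n y _; rewrite lee_fin mulr_ge0.
  - move=> y _ a b ab; rewrite lee_fin ler_wpM2r//.
    exact/lefP/nd_nnsfun_approx.
congr (limn _); apply/funext => n.
rewrite integralT_nnsfun sintegralE.
transitivity (\int[m]_y \sum_(r \in range (g_ n))
    (r%:E * (\1_(g_ n @^-1` [set r]) (phi y) * h y)%:E)); last first.
  apply: eq_integral => y _; rewrite fimfunE mulr_fsuml -fsumEFin//.
  by apply: eq_fsbigr => r _; rewrite -EFinM mulrA.
have mi r : measurable_fun setT
    (fun y => (\1_(g_ n @^-1` [set r]) (phi y) * h y)%:E).
  apply/measurable_EFinP/measurable_funM => //.
  by apply: (measurableT_comp _ mphi).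
have i0 r y : 0 <= (\1_(g_ n @^-1` [set r]) (phi y) * h y)%:E.
  by rewrite lee_fin mulr_ge0.
rewrite [RHS]ge0_integral_fsum//.
- apply: eq_fsbigr => r _; rewrite nuE//.
  have [r0|r0] := leP 0%R r; first by rewrite ge0_integralZl.
  rewrite preimage_nnfun0// !integral0_eq ?mule0// => y _.
    by rewrite indic0 mul0r mule0.
  by rewrite indic0 mul0r.
- by move=> r; apply: measurable_funeM.
- move=> r y _; have [r0|r0] := leP 0%R r; first by rewrite mule_ge0.
  by rewrite preimage_nnfun0// indic0 mul0r mule0.
Qed.

End integral_image_density.

Lemma hamiltonian_nn1 (R : realType) (U : circle R -> R) (k : int)
    (w : config R) :
  hamiltonian (nn_interaction U) [fset k]%fset w =
  - (U (w (k - 1) - w k) + U (w k - w (k + 1))).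
Proof.
rewrite /hamiltonian.
have ne : [fset (k - 1)%R; k]%fset != [fset k; (k + 1)%R]%fset.
  by apply/eqP => /fsetP /(_ (k - 1)); rewrite !inE eqxx; lia.
rewrite (fsbigE [:: [fset (k - 1)%R; k]%fset; [fset k; (k + 1)%R]%fset]).
- rewrite !big_cons big_nil !ifT; last 2 first.
  + by rewrite inE /=; apply/fset0Pn; exists k; rewrite !inE eqxx.
  + by rewrite inE /=; apply/fset0Pn; exists k; rewrite !inE eqxx orbT.
  have {1}-> : [fset (k - 1)%R; k]%fset = [fset (k - 1)%R; (k - 1 + 1)%R]%fset.
    by rewrite subrK.
  by rewrite !nn_interaction_pair subrK /= addr0 opprD.
- by rewrite /= inE ne.
- move=> X /=; rewrite !inE => /orP[]/eqP->; apply/fset0Pn; exists k; rewrite !inE eqxx ?orbT//.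
- move=> X /= /fset0Pn[j]; rewrite !inE => /andP[jX /eqP jk].
  rewrite negb_or => /andP[/eqP X1 /eqP X2].
  apply: nn_interaction_other => i XE.
  move: jX; rewrite jk XE !inE => /orP[]/eqP ki.
    by apply: X2; rewrite XE ki.
  by apply: X1; rewrite XE ki addrK.
Qed.

Lemma integral_sites1 (R : realType) (k : int) (f : config R -> \bar R) w :
  integral_sites [fset k]%fset f w = (\int[@circle_leb R]_x f (dfwith w k x))%E.
Proof.
suff -> : ([fset k]%fset : seq int) = [:: k] by [].
apply: perm_small_eq => //; apply: uniq_perm => //; first exact: fset_uniq.
by move=> j; rewrite !inE.
Qed.

Section cylinders.
Variable R : realType.
Local Notation T := (circle R).

(* The sigma-algebra generated by the coordinates: unlike for the Borel sets of
   [config R], joint measurability of [dfwith] is immediate for it. *)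
Definition cyl : Type := config R.
HB.instance Definition _ := Pointed.on cyl.

Definition cylinders : set (set cyl) :=
  \bigcup_k preimage_set_system setT (fun w : cyl => w k : T) measurable.

HB.instance Definition _ :=
  Measurable.copy cyl (g_sigma_algebraType cylinders).

Lemma measurable_coord (k : int) : measurable_fun [set: cyl] (fun w => w k : T).
Proof.
move=> _ A mA; apply: sub_sigma_algebra; exists k => //.
by exists A.
Qed.

Lemma measurable_to_cyl d (X : measurableType d) (f : X -> cyl) :
  (forall k, measurable_fun [set: X] (fun x => f x k : T)) ->
  measurable_fun [set: X] f.
Proof.
move=> mf; apply: (@measurability _ _ _ _ _ _ cylinders) => //.
move=> _ [_ [k _ [A mA <-]] <-]; rewrite !setTI.
by have := mf k measurableT A mA; rewrite setTI.
Qed.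

Lemma measurable_config_coord (k : int) :
  measurable_fun [set: config R] (fun w => w k : T).
Proof.
apply: (@measurability _ _ _ T _ _ (@open T)) => // _ [A oA <-].
rewrite setTI; apply: sub_sigma_algebra.
by apply: open_comp => // w _; exact: proj_continuous.
Qed.

Lemma measurable_config_cyl : measurable_fun [set: config R] (id : config R -> cyl).
Proof. by apply: measurable_to_cyl => k; exact: measurable_config_coord. Qed.

Lemma measurable_difference : measurable_fun [set: config R] (@difference R).
Proof.
by apply: measurable_circleB; exact: measurable_config_coord.
Qed.

Definition upd (w : cyl) (k : int) (x : T) : cyl := dfwith w k x.

Lemma updE w k x : upd w k x k = x.
Proof. exact: dfwithin. Qed.

Lemma updN w k x j : j != k -> upd w k x j = w j.
Proof. by move=> jk; rewrite /upd dfwithout// eq_sym. Qed.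

Lemma upd_upd w k x y : upd (upd w k x) k y = upd w k y.
Proof.
apply: functional_extensionality_dep => j.
have [->|jk] := eqVneq j k; first by rewrite !updE.
by rewrite !updN.
Qed.

Lemma measurable_upd k :
  measurable_fun [set: cyl * T] (fun z => upd z.1 k z.2).
Proof.
apply: measurable_to_cyl => j; have [->|jk] := eqVneq j k.
  under eq_fun do rewrite updE.
  exact: measurable_snd.
under eq_fun do rewrite updN//.
exact: measurableT_comp (@measurable_coord j) measurable_fst.
Qed.

Definition resample (k : int) (g : cyl -> \bar R) (w : cyl) : \bar R :=
  (\int[@circle_leb R]_x g (upd w k x))%E.

Lemma measurable_resample k g : measurable_fun setT g -> (forall w, 0 <= g w)%E ->
  measurable_fun setT (resample k g).
Proof.
move=> mg g0.
apply: (@measurable_fun_fubini_tonelli_F _ _ _ _ _ (@circle_leb R) (fun z => g (upd z.1 k z.2))).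
  by apply: measurableT_comp => //; exact: measurable_upd.
by move=> z; exact: g0.
Qed.

Lemma resample_upd k g w x : resample k g (upd w k x) = resample k g w.
Proof. by apply: eq_integral => y _; rewrite upd_upd. Qed.

Lemma measurable_updw k w : measurable_fun [set: T] (upd w k).
Proof.
apply: measurable_to_cyl => j; have [->|jk] := eqVneq j k.
  under eq_fun do rewrite updE.
  exact: measurable_id.
under eq_fun do rewrite updN//.
exact: measurable_cst.
Qed.

End cylinders.

(** * One-site DLR equations for a bounded bond weight *)

Section resampling.
Variable R : realType.
Local Notation T := (circle R).
Local Notation cyl := (cyl R).
Variables (p : T -> R) (c M : R).
Hypotheses (mp : measurable_fun setT p) (c0 : 0 < c).
Hypotheses (pc : forall x, c <= p x) (pM : forall x, p x <= M).

Lemma p_gt0 x : 0 < p x. Proof. exact: lt_le_trans (pc x). Qed.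
Lemma p_ge0 x : 0 <= p x. Proof. exact/ltW/p_gt0. Qed.

Definition bond (i : int) (w : cyl) : R := p (w i - w (i + 1)).

Lemma bond_gt0 i w : 0 < bond i w. Proof. exact: p_gt0. Qed.
Lemma bond_ge0 i w : 0 <= bond i w. Proof. exact: p_ge0. Qed.

Lemma measurable_bond i : measurable_fun setT (bond i).
Proof.
by apply: measurableT_comp => //; apply: measurable_circleB; exact: measurable_coord.
Qed.

Lemma bond_upd i k w x : i != k -> i + 1 != k -> bond i (upd w k x) = bond i w.
Proof. by move=> ik i1k; rewrite /bond !updN. Qed.

(** The Boltzmann factor of the single site [k]: the two bonds that see its coordinate. *)
Definition site (k : int) (w : cyl) : R := bond (k - 1) w * bond k w.

Lemma site_gt0 k w : 0 < site k w.
Proof. by rewrite mulr_gt0// bond_gt0. Qed.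
Lemma site_ge0 k w : 0 <= site k w.
Proof. exact/ltW/site_gt0. Qed.

Lemma measurable_site k : measurable_fun setT (site k).
Proof. by apply: measurable_funM; exact: measurable_bond. Qed.

Definition site_norm k w := resample k (EFin \o site k) w.

Lemma site_norm_fin k w : (0 < fine (site_norm k w)) /\ site_norm k w \is a fin_num.
Proof.
have lb : ((c * c)%:E <= site_norm k w)%E.
  have <- : (\int[@circle_leb R]_x (c * c)%:E = (c * c)%:E)%E.
    exact: integral_circle_cst.
  apply: ge0_le_integral => //.
  - by move=> x _; rewrite lee_fin mulr_ge0 ?ltW.
  - apply/measurable_EFinP; apply: measurableT_comp; first exact: measurable_site.
    exact: measurable_updw.
  - by move=> x _; rewrite lee_fin /= /site ler_pM ?(ltW c0)// pc.
have ub : (site_norm k w <= (M * M)%:E)%E.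
  have <- : (\int[@circle_leb R]_x (M * M)%:E = (M * M)%:E)%E.
    exact: integral_circle_cst.
  apply: ge0_le_integral => //.
  - by move=> x _; rewrite lee_fin; exact: site_ge0.
  - apply/measurable_EFinP; apply: measurableT_comp; first exact: measurable_site.
    exact: measurable_updw.
  - by move=> x _; rewrite lee_fin /= /site ler_pM ?bond_ge0// pM.
have fn : site_norm k w \is a fin_num.
  by rewrite fin_numE; apply/andP; split; apply/eqP => E; rewrite E in lb ub.
by split=> //; rewrite -lte_fin fineK//; apply: lt_le_trans lb; rewrite lte_fin mulr_gt0.
Qed.

Lemma measurable_site_norm k : measurable_fun setT (site_norm k).
Proof.
apply: measurable_resample; first by apply/measurable_EFinP; exact: measurable_site.
by move=> w; rewrite lee_fin site_ge0.
Qed.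

Lemma resample_ge0 k (g : cyl -> \bar R) w : (forall v, 0 <= g v)%E -> (0 <= resample k g w)%E.
Proof. by move=> g0; apply: integral_ge0. Qed.

Lemma resample_id k (g : cyl -> \bar R) : resample k (resample k g) = resample k g.
Proof.
apply/funext => w; rewrite {1}/resample.
under eq_integral do rewrite resample_upd.
exact: integral_circle_cst.
Qed.

Lemma resampleZr k (g : cyl -> \bar R) (V : cyl -> R) w :
  measurable_fun setT g -> (forall v, 0 <= g v)%E -> (0 <= V w) ->
  (forall x, V (upd w k x) = V w) ->
  (resample k (fun v => g v * (V v)%:E) w = resample k g w * (V w)%:E)%E.
Proof.
move=> mg g0 V0 Vk; rewrite /resample.
under eq_integral do rewrite Vk.
rewrite ge0_integralZr//.
by apply: measurableT_comp => //; exact: measurable_updw.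
Qed.

Variable nu : probability cyl R.
Hypothesis dlr : forall k (A : set cyl), measurable A ->
  nu A = (\int[nu]_w \int[@circle_leb R]_x
    (\1_A (upd w k x) *
      ((fine (site_norm k w))^-1 * site k (upd w k x)))%:E)%E.

Lemma dlr_fun k (g : cyl -> \bar R) : measurable_fun setT g ->
  (forall w, 0 <= g w)%E ->
  (\int[nu]_w g w = \int[nu]_w \int[@circle_leb R]_x
    (g (upd w k x) * ((fine (site_norm k w))^-1 * site k (upd w k x))%:E))%E.
Proof.
move=> mg g0.
pose h (z : cyl * T) := (fine (site_norm k z.1))^-1 * site k (upd z.1 k z.2).
have mh : measurable_fun setT h.
  apply: measurable_funM; last first.
    apply: measurableT_comp; [exact: measurable_site|exact: measurable_upd].
  apply: (measurableT_comp (f := fun w => (fine (site_norm k w))^-1)) => //.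
  apply: measurable_funV_gt0; last by move=> w; have [] := site_norm_fin k w.
  apply: measurableT_comp => //; exact: measurable_site_norm.
have h0 z : 0 <= h z.
  rewrite mulr_ge0 ?site_ge0// invr_ge0 ltW//.
  by have [] := site_norm_fin k z.1.
rewrite (@ge0_integral_image_density _ _ _ _ R nu (nu \x @circle_leb R)%E
  (fun z : cyl * T => upd z.1 k z.2) h)//.
- rewrite fubini_tonelli1//.
  + apply: emeasurable_funM; last exact/measurable_EFinP.
    by apply: measurableT_comp => //; exact: measurable_upd.
  + by move=> z; rewrite mule_ge0// lee_fin.
- exact: measurable_upd.
- move=> A mA; apply: (etrans (dlr k mA)).
  rewrite [RHS](_ : _ = \int[nu \x @circle_leb R]_z
    ((fun z => (\1_A (upd z.1 k z.2) * h z)%:E) z))%E//.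
  rewrite fubini_tonelli1//.
  + apply/measurable_EFinP/measurable_funM => //.
    exact: (measurableT_comp (measurable_indic mA) (@measurable_upd R k)).
  + by move=> z; rewrite lee_fin mulr_ge0.
Qed.

(** Dividing by the weight at [k] cancels the conditional density, so that the coordinate [k]
    becomes uniform. By [key] each side depends on its integrand only through [resample k], which is
    idempotent. *)
Lemma resample_site k (g : cyl -> \bar R) : measurable_fun setT g ->
  (forall w, 0 <= g w)%E ->
  (\int[nu]_w (g w * ((site k w)^-1)%:E) =
   \int[nu]_w (resample k g w * ((site k w)^-1)%:E))%E.
Proof.
have key (f : cyl -> \bar R) : measurable_fun setT f ->
    (forall w, 0 <= f w)%E ->
    (\int[nu]_w (f w * ((site k w)^-1)%:E) =
     \int[nu]_w (resample k f w * ((fine (site_norm k w))^-1)%:E))%E.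
  move=> mf f0; rewrite (dlr_fun k).
  - apply: eq_integral => w _; rewrite -ge0_integralZr//.
    + apply: eq_integral => x _; rewrite -muleA -EFinM; congr (_ * _%:E)%E.
      by rewrite mulrCA mulVf ?mulr1// gt_eqF// site_gt0.
    + by apply: measurableT_comp => //; exact: measurable_updw.
    + by rewrite lee_fin invr_ge0 ltW//; have [] := site_norm_fin k w.
  - apply: emeasurable_funM => //; apply/measurable_EFinP/measurable_funV_gt0.
      exact: measurable_site.
    exact: site_gt0.
  - by move=> w; rewrite mule_ge0// lee_fin invr_ge0 site_ge0.
move=> mg g0; rewrite key// key ?resample_id//.
- exact: measurable_resample.
- by move=> w; exact: resample_ge0.
Qed.

(** * Resampling along a chain of sites; iterated kernels *)

Definition chain (n : nat) (w : cyl) : R := \prod_(i < n) bond i%:Z w.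

Lemma chain_gt0 n w : 0 < chain n w.
Proof. by apply: prodr_gt0 => i _; exact: bond_gt0. Qed.

Lemma measurable_chain n : measurable_fun setT (chain n).
Proof.
by apply: measurable_prod => i _; exact: measurable_bond.
Qed.

Lemma resample_chain n k (g : cyl -> \bar R) : (k < n)%N ->
  measurable_fun setT g -> (forall w, 0 <= g w)%E ->
  (\int[nu]_w (g w * ((chain n.+1 w)^-1)%:E) =
   \int[nu]_w (resample k.+1%:Z g w * ((chain n.+1 w)^-1)%:E))%E.
Proof.
move=> kn mg g0.
(* Only the bonds [k] and [k.+1] touch the site [k.+1]; all the others form [V], which passes
   through the resampling as a constant. *)
pose V w := \prod_(i < n.+1 | (i != inord k) && (i != inord k.+1)) bond i%:Z w.
have V0 w : 0 < V w by apply: prodr_gt0 => i _; exact: bond_gt0.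
have mV : measurable_fun setT (fun w => (V w)^-1).
  apply: measurable_funV_gt0 => //.
  have -> : V = fun w => \prod_(i < n.+1)
      (if (i != inord k) && (i != inord k.+1) then bond i%:Z w else 1).
    by apply/funext => w; rewrite /V big_mkcond.
  apply: measurable_prod => i _.
  have [_|_] := boolP ((i != inord k) && _); last exact: measurable_cst.
  exact: measurable_bond.
have chainE w : ((chain n.+1 w)^-1)%:E = ((V w)^-1%:E * (site k.+1%:Z w)^-1%:E)%E.
  rewrite -EFinM -invfM; congr (_^-1)%:E.
  rewrite /chain (bigD1 (inord k))//= (bigD1 (inord k.+1))/=; last first.
    by apply/eqP => /(congr1 val); rewrite /= !inordK//; lia.
  rewrite mulrA mulrC; congr (_ * _).
  by rewrite /site !inordK ?ltnS// 1?ltnW// -addn1 PoszD addrK.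
under eq_integral do rewrite chainE muleA.
under [RHS]eq_integral do rewrite chainE muleA.
rewrite resample_site; last 2 first.
- by apply: emeasurable_funM => //; exact/measurable_EFinP.
- by move=> w; rewrite mule_ge0// lee_fin invr_ge0 ltW.
apply: eq_integral => w _; rewrite (@resampleZr _ _ (fun w => (V w)^-1))//.
- by rewrite invr_ge0 ltW.
- move=> x; congr (_^-1); apply: eq_bigr => i /andP[ik ik1].
  apply: bond_upd.
    by apply: contra_neq ik1 => -[ik1]; apply: val_inj; rewrite /= inordK.
  apply: contra_neq ik => ik; apply: val_inj; rewrite /= inordK ?(ltnW kn)//; lia.
Qed.

(** The convolution power of [p] with [n.+1] factors, kept as a function of both ends of a path with
    [n] sites integrated out. *)
Fixpoint kern (n : nat) : T * T -> \bar R :=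
  if n is n'.+1 then
    fun z => (\int[@circle_leb R]_x ((p (z.1 - x))%:E * kern n' (x, z.2)))%E
  else fun z => (p (z.1 - z.2))%:E.

Lemma kern_ge0 n z : (0 <= kern n z)%E.
Proof.
elim: n z => [|n IH] z /=; first by rewrite lee_fin p_ge0.
by apply: integral_ge0 => x _; rewrite mule_ge0// lee_fin p_ge0.
Qed.

Lemma measurable_kern n : measurable_fun setT (kern n).
Proof.
elim: n => [|n IH] /=.
  apply/measurable_EFinP/measurableT_comp => //.
  by apply: measurable_circleB; [exact: measurable_fst|exact: measurable_snd].
apply: (@measurable_fun_fubini_tonelli_F _ _ _ _ _ (@circle_leb R)
  (fun v : (T * T) * T => ((p (v.1.1 - v.2))%:E * kern n (v.2, v.1.2))%E)).
  apply: emeasurable_funM.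
    apply/measurable_EFinP/measurableT_comp => //; apply: measurable_circleB => //.
    exact: measurableT_comp measurable_fst measurable_fst.
  apply: measurableT_comp => //; apply: measurable_fun_pair => //.
  exact: measurableT_comp measurable_snd measurable_fst.
by move=> v; rewrite mule_ge0 ?kern_ge0// lee_fin p_ge0.
Qed.

Lemma measurable_kernl n z : measurable_fun setT (fun x => kern n (x, z)).
Proof.
apply: measurableT_comp; first exact: measurable_kern.
exact: measurable_fun_pair.
Qed.

Lemma measurable_pB y : measurable_fun setT (fun x : T => p (y - x)).
Proof.
by apply: measurableT_comp => //; apply: measurable_circleB => //; exact: measurable_cst.
Qed.

Definition mass : R := fine (\int[@circle_leb R]_x (p x)%:E)%E.

Lemma massE : (\int[@circle_leb R]_x (p x)%:E = mass%:E)%E /\ c <= mass.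
Proof.
have lb : (c%:E <= \int[@circle_leb R]_x (p x)%:E)%E.
  rewrite -[c%:E]integral_circle_cst; apply: ge0_le_integral => //.
  - by move=> x _; rewrite lee_fin ltW.
  - exact/measurable_EFinP.
  - by move=> x _; rewrite lee_fin pc.
have ub : (\int[@circle_leb R]_x (p x)%:E <= M%:E)%E.
  rewrite -[M%:E]integral_circle_cst; apply: ge0_le_integral => //.
  - by move=> x _; rewrite lee_fin p_ge0.
  - exact/measurable_EFinP.
  - by move=> x _; rewrite lee_fin pM.
have fn : (\int[@circle_leb R]_x (p x)%:E)%E \is a fin_num.
  by rewrite fin_numE; apply/andP; split; apply/eqP => E; rewrite E in lb ub.
by split; rewrite /mass ?fineK// -lee_fin fineK.
Qed.

Lemma mass_gt0 : 0 < mass.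
Proof. by apply: lt_le_trans c0 _; exact: massE.2. Qed.

Lemma massB y : (\int[@circle_leb R]_x (p (y - x))%:E = mass%:E)%E.
Proof.
rewrite -massE.1 -(@ge0_integral_circle_reflection _ y (fun x => (p x)%:E))//.
  exact/measurable_EFinP.
by move=> x; rewrite lee_fin p_ge0.
Qed.

Lemma mass_excess y :
  (\int[@circle_leb R]_x (p (y - x) - c)%:E = (mass - c)%:E)%E.
Proof.
set J := LHS.
have : (\int[@circle_leb R]_x ((p (y - x) - c)%:E + c%:E) = mass%:E)%E.
  by rewrite -(massB y); apply: eq_integral => x _; rewrite -EFinD subrK.
rewrite ge0_integralD//; last 3 first.
- by move=> x _; rewrite lee_fin subr_ge0 pc.
- by apply/measurable_EFinP/measurable_funB => //; exact: measurable_pB.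
- by move=> x _; rewrite lee_fin ltW.
rewrite integral_circle_cst -/J.
by case: J => [r| |]//= [<-]; rewrite addrK.
Qed.

(* Doeblin: the lower bound [c] for the density makes the relative oscillation
   of the iterated kernel contract geometrically. *)
Lemma kern_bounds n z : exists m M' : R, [/\ 0 < m,
  M' - m <= (1 - c / mass) ^+ n * ((M - c) / c) * m &
  forall x, (m%:E <= kern n (x, z) <= M'%:E)%E].
Proof.
elim: n => [|n [m [M' [m0 mM' bnd]]]].
  exists c, M; split => //=; first by rewrite expr0 mul1r mulfVK ?gt_eqF.
  by move=> x; rewrite !lee_fin pc pM.
have [_ cmass] := massE; have mass0 := mass_gt0.
pose S := (\int[@circle_leb R]_x kern n (x, z))%E.
have mS : (m%:E <= S)%E.
  rewrite -[m%:E]integral_circle_cst; apply: ge0_le_integral => //.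
  - by move=> x _; rewrite lee_fin ltW.
  - exact: measurable_kernl.
  - by move=> x _; have /andP[] := bnd x.
have SM : (S <= M'%:E)%E.
  rewrite -[M'%:E]integral_circle_cst; apply: ge0_le_integral => //.
  - by move=> x _; exact: kern_ge0.
  - exact: measurable_kernl.
  - by move=> x _; have /andP[] := bnd x.
have [s SE] : exists s, S = s%:E.
  by case: S mS SM => [s| |]//; exists s.
move: mS SM; rewrite SE !lee_fin => ms sM.
have mix y r : 0 <= r -> (\int[@circle_leb R]_x
    (c%:E * kern n (x, z) + r%:E * (p (y - x) - c)%:E) =
    (c * s + r * (mass - c))%:E)%E.
  move=> r0; rewrite ge0_integralD//; last 4 first.
  - by move=> x _; rewrite mule_ge0 ?kern_ge0// lee_fin ltW.
  - by apply: measurable_funeM; exact: measurable_kernl.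
  - by move=> x _; rewrite mule_ge0// lee_fin subr_ge0 pc.
  - apply: measurable_funeM; apply/measurable_EFinP/measurable_funB => //.
    exact: measurable_pB.
  rewrite !ge0_integralZl//.
  - by rewrite mass_excess -/S SE.
  - by apply/measurable_EFinP/measurable_funB => //; exact: measurable_pB.
  - by move=> x _; rewrite lee_fin subr_ge0 pc.
  - exact: measurable_kernl.
  - by move=> x _; exact: kern_ge0.
  - by rewrite lee_fin ltW.
have m'0 : 0 <= M' by apply: le_trans (ltW m0) (le_trans ms sM).
have mmix y r : 0 <= r -> measurable_fun setT (fun x : T =>
    (c%:E * kern n (x, z) + r%:E * (p (y - x) - c)%:E)%E).
  move=> r0; apply: emeasurable_funD; apply: measurable_funeM.
    exact: measurable_kernl.
  by apply/measurable_EFinP/measurable_funB => //; exact: measurable_pB.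
have mint y : measurable_fun setT (fun x : T =>
    ((p (y - x))%:E * kern n (x, z))%E).
  apply: emeasurable_funM; last exact: measurable_kernl.
  by apply/measurable_EFinP; exact: measurable_pB.
(* In the splitting [p = c + (p - c)] the constant part contributes [c * s] whatever the starting
   point, so only the remaining mass [mass - c] transmits the oscillation. *)
exists (c * s + m * (mass - c)), (c * s + M' * (mass - c)); split.
- by rewrite ltr_wpDr ?mulr_gt0// ?mulr_ge0 ?subr_ge0 ?(ltW m0)// (lt_le_trans m0).
- rewrite opprD addrACA subrr add0r -mulrBl.
  apply: le_trans (ler_wpM2r _ mM') _; first by rewrite subr_ge0.
  have -> : (1 - c / mass) ^+ n * ((M - c) / c) * m * (mass - c) =
    (1 - c / mass) ^+ n.+1 * ((M - c) / c) * (mass * m).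
    by rewrite exprSr; field; rewrite !gt_eqF.
  apply: ler_wpM2l.
    rewrite mulr_ge0// ?exprn_ge0 ?subr_ge0 ?ler_pdivrMr ?mul1r//.
    rewrite divr_ge0 ?(ltW c0)// subr_ge0.
    exact: le_trans (pc 0) (pM 0).
  have := ler_wpM2l (ltW c0) ms; lra.
- move=> y; apply/andP; split.
    rewrite -(mix y) ?(ltW m0)//=; apply: ge0_le_integral => //.
    + move=> x _.
      rewrite adde_ge0// mule_ge0 ?kern_ge0 ?lee_fin ?subr_ge0 ?(ltW m0) ?(ltW c0) ?pc//.
    + by apply: mmix; exact: ltW.
    + move=> x _; have /andP[] := bnd x; case: (kern n (x, z)) => [q| |]//=.
      rewrite !lee_fin => mq _; have := pc (y - x); nra.
  rewrite -(mix y)//=; apply: ge0_le_integral => //.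
  + by move=> x _; rewrite mule_ge0 ?kern_ge0// lee_fin p_ge0.
  + exact: mmix.
  + move=> x _; have /andP[] := bnd x; case: (kern n (x, z)) => [q| |]//=.
    rewrite !lee_fin => _ qM; have := pc (y - x); nra.
Qed.

(** The contraction is relative to the lower bound [m], which may depend on [z]; this is what makes
    [n] uniform in all three points. *)
Lemma kern_ratio e : 0 < e -> exists n, forall x y z,
  (kern n (x, z) <= (1 + e)%:E * kern n (y, z))%E.
Proof.
move=> e0; have [_ cmass] := massE; have mass0 := mass_gt0.
have [n nE] : exists n, (1 - c / mass) ^+ n * ((M - c) / c) <= e.
  have /cvg_geometric : `|1 - c / mass| < 1.
    rewrite ger0_norm ?subr_ge0 ?ler_pdivrMr ?mul1r//.
    by rewrite ltrBlDr ltrDl divr_gt0.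
  move=> /(_ ((M - c) / c)) /cvgr0_norm_le /(_ e e0)[n _ /(_ n (leqnn n))] nE.
  by exists n; rewrite mulrC; apply: le_trans nE; exact: ler_norm.
exists n => x y z; have [m [M' [m0 mM' bnd]]] := kern_bounds n z.
have /andP[_ /le_trans] := bnd x; apply.
have /andP[my _] := bnd y.
have : ((1 + e)%:E * m%:E <= (1 + e)%:E * kern n (y, z))%E.
  by apply: lee_wpmul2l my; rewrite lee_fin addr_ge0// ltW.
apply: le_trans; rewrite -EFinM lee_fin mulrDl mul1r -lerBlDl.
by apply: le_trans mM' _; rewrite ler_wpM2r// ltW.
Qed.

(** * Law of one increment *)

Definition step (w : cyl) : T := w 0 - w 1.

Lemma measurable_step : measurable_fun setT step.
Proof. by apply: measurable_circleB; exact: measurable_coord. Qed.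

Lemma chainS n w : chain n.+1 w = chain n w * bond n%:Z w.
Proof. by rewrite /chain big_ord_recr. Qed.

Lemma chain_upd n k w x : (n < k)%N -> chain n (upd w k%:Z x) = chain n w.
Proof.
by move=> nk; apply: eq_bigr => i _; apply: bond_upd; have := ltn_ord i; lia.
Qed.

(** The integrand once the sites [j.+1] to [n] have been integrated out: the bonds before [j]
    remain, and the kernel joins the site [j] to the fixed end [n.+1]. *)
Definition partial (B : set T) (n j : nat) (w : cyl) : \bar R :=
  (kern (n - j) (w j%:Z, w n.+1%:Z) * (\1_B (step w) * chain j w)%:E)%E.

Lemma partial_ge0 B n j w : (0 <= partial B n j w)%E.
Proof. by rewrite mule_ge0 ?kern_ge0// lee_fin mulr_ge0// ltW// chain_gt0. Qed.

Lemma measurable_end n i j :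
  measurable_fun setT (fun w : cyl => kern n (w i, w j)).
Proof.
apply: measurableT_comp; first exact: measurable_kern.
by apply: measurable_fun_pair; exact: measurable_coord.
Qed.

Lemma measurable_indic_step (B : set T) : measurable B ->
  measurable_fun setT (fun w : cyl => \1_B (step w) : R).
Proof. by move=> mB; exact: (measurableT_comp (measurable_indic mB) measurable_step). Qed.

Lemma measurable_partial B n j : measurable B ->
  measurable_fun setT (partial B n j).
Proof.
move=> mB; apply: emeasurable_funM; first exact: measurable_end.
apply/measurable_EFinP/measurable_funM; last exact: measurable_chain.
exact: measurable_indic_step.
Qed.

Lemma resample_partial B n j : measurable B -> (j.+2 <= n)%N ->
  resample j.+2%:Z (partial B n j.+2) = partial B n j.+1.
Proof.
move=> mB jn; apply/funext => w.
transitivity (resample j.+2%:Z (fun v =>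
    (kern (n - j.+2) (v j.+2%:Z, v n.+1%:Z) * (bond j.+1%:Z v)%:E) *
    (\1_B (step v) * chain j.+1 v)%:E)%E w).
  congr (resample _ _ w); apply/funext => v.
  by rewrite /partial chainS -muleA -EFinM; congr (_ * _%:E)%E; ring.
rewrite (@resampleZr _ _ (fun v => \1_B (step v) * chain j.+1 v)).
- rewrite /partial; congr (_ * _)%E.
  have -> : (n - j.+1 = (n - j.+2).+1)%N by lia.
  rewrite /resample /=; apply: eq_integral => x _.
  rewrite muleC updE updN; last lia.
  have E : j.+1%:Z + 1 = j.+2%:Z by lia.
  by rewrite /bond E updE updN//; lia.
- apply: emeasurable_funM; first exact: measurable_end.
  by apply/measurable_EFinP; exact: measurable_bond.
- by move=> v; rewrite mule_ge0 ?kern_ge0// lee_fin bond_ge0.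
- by rewrite mulr_ge0// ltW// chain_gt0.
- by move=> x; rewrite chain_upd// /step !updN.
Qed.

(** For [j = 0] the integrand is the indicator times the full chain, which the denominator cancels.
    Each further [j] resamples one more site, from [n.+1] downwards; the site 1 is left untouched
    because the increment reads it. *)
Lemma integral_partial B n j : measurable B -> (j <= n)%N ->
  nu (step @^-1` B) =
  (\int[nu]_w (partial B n.+1 (n.+1 - j)%N w * ((chain n.+2 w)^-1)%:E))%E.
Proof.
move=> mB; elim: j => [_|j IH jn].
  rewrite subn0.
  have -> : nu (step @^-1` B) = (\int[nu]_w (\1_(step @^-1` B) w)%:E)%E.
    rewrite integral_indic// ?setIT//.
    by rewrite -[X in measurable X]setTI; exact: measurable_step.
  apply: eq_integral => w _.
  rewrite /partial subnn /= -!EFinM; congr EFin.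
  have -> : p (w n.+1 - w n.+2) = bond n.+1%:Z w.
    by rewrite /bond; congr (p (_ - w _)); lia.
  rewrite mulrCA mulrAC -mulrA mulrC [bond _ _ * _]mulrC -chainS.
  by rewrite mulVf ?mul1r// gt_eqF ?chain_gt0.
rewrite IH; last lia.
have -> : (n.+1 - j = (n - j.+1).+2)%N by lia.
rewrite (@resample_chain _ (n - j.+1).+1); last 3 first.
- lia.
- exact: measurable_partial.
- exact: partial_ge0.
rewrite resample_partial//; last lia.
by have -> : (n.+1 - j.+1 = (n - j.+1).+1)%N by lia.
Qed.

(** A uniform [w 1] makes [w 0 - w 1] uniform whatever [w 0] is, by reflection; the result no longer
    mentions [w 0] except through [f]. *)
Lemma resample_first B (f : cyl -> \bar R) w : measurable B ->
  (forall v, 0 <= f v)%E -> measurable_fun setT f ->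
  (forall x, f (upd w 1 x) = f w) ->
  resample 1 (fun v => f v * (\1_B (step v) * p (step v))%:E)%E w =
  (f w * \int[@circle_leb R]_x (\1_B x * p x)%:E)%E.
Proof.
move=> mB f0 mf f1.
have mBp : measurable_fun setT (fun x : T => (\1_B x * p x)%:E).
  by apply/measurable_EFinP/measurable_funM.
have Bp0 x : (0 <= (\1_B x * p x)%:E)%E by rewrite lee_fin mulr_ge0// p_ge0.
rewrite -(@ge0_integral_circle_reflection _ (w 0) (fun x => (\1_B x * p x)%:E))//.
rewrite -ge0_integralZl//.
- by apply: eq_integral => x _; rewrite f1 /step updE updN.
- by apply: (measurableT_comp mBp); apply: measurable_circleB => //; exact: measurable_cst.
Qed.

(** Moving the start of the kernel from [w 1] to the arbitrary point 0 costs a factor [1 + e] and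
    decouples the increment from the rest, whose contribution [L] does not depend on the set. One
    factor comes from bounding [B] from above, the other from normalising [L] by means of the whole
    circle. *)
Lemma step_law_approx B e : measurable B -> 0 < e ->
  (nu (step @^-1` B) * mass%:E <=
   ((1 + e) ^+ 2)%:E * \int[@circle_leb R]_x (\1_B x * p x)%:E)%E.
Proof.
move=> mB e0; have [n kn] := kern_ratio e0.
have e1 : 0 <= 1 + e by rewrite addr_ge0// ltW.
have first C : measurable C -> nu (step @^-1` C) =
    (\int[nu]_w (partial C n.+1 1 w * ((chain n.+2 w)^-1)%:E))%E.
  by move=> mC; rewrite (@integral_partial C n n)// subSnn.
have partialE C w : partial C n.+1 1 w =
    (kern n (w 1%R, w n.+2%:Z) * (\1_C (step w) * p (step w))%:E)%E.
  by rewrite /partial subn1 /= chainS /chain big_ord0 mul1r.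
pose a (w : cyl) := kern n (0, w n.+2%:Z).
have a0 w : (0 <= a w)%E by exact: kern_ge0.
have ma : measurable_fun setT a.
  apply: measurableT_comp; first exact: measurable_kern.
  by apply: measurable_fun_pair => //; exact: measurable_coord.
pose L := (\int[nu]_w (a w * ((chain n.+2 w)^-1)%:E))%E.
have ch0 w : (0 <= ((chain n.+2 w)^-1)%:E)%E.
  by rewrite lee_fin invr_ge0 ltW// chain_gt0.
have mch : measurable_fun setT (fun w => ((chain n.+2 w)^-1)%:E).
  apply/measurable_EFinP/measurable_funV_gt0; first exact: measurable_chain.
  exact: chain_gt0.
have mstep C : measurable C -> measurable_fun setT
    (fun w => ((\1_C (step w) : R) * p (step w))%:E).
  move=> mC; apply/measurable_EFinP/measurable_funM; first exact: measurable_indic_step.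
  by apply: measurableT_comp => //; exact: measurable_step.
have step0 C w : (0 <= (\1_C (step w) * p (step w))%:E)%E.
  by rewrite lee_fin mulr_ge0// p_ge0.
have IC C : measurable C ->
    (\int[nu]_w ((a w * (\1_C (step w) * p (step w))%:E) * ((chain n.+2 w)^-1)%:E) =
     (\int[@circle_leb R]_x (\1_C x * p x)%:E) * L)%E.
  move=> mC; rewrite (@resample_chain n.+1 0)//; last 2 first.
  - by apply: emeasurable_funM => //; exact: mstep.
  - by move=> w; rewrite mule_ge0.
  rewrite -ge0_integralZl//.
  - apply: eq_integral => w _; rewrite resample_first//.
      by rewrite muleAC muleC.
    by move=> x; rewrite /a updN.
  - by apply: emeasurable_funM.
  - by move=> w _; rewrite mule_ge0.
  - by apply: integral_ge0 => x _; rewrite lee_fin mulr_ge0// p_ge0.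
have up : (nu (step @^-1` B) <= (1 + e)%:E *
    ((\int[@circle_leb R]_x (\1_B x * p x)%:E) * L))%E.
  rewrite first// -IC// -ge0_integralZl//; last 2 first.
  - by do 2 apply: emeasurable_funM => //; exact: mstep.
  - by move=> w _; rewrite mule_ge0// mule_ge0.
  apply: ge0_le_integral => //.
  - by move=> w _; rewrite mule_ge0// partial_ge0.
  - by apply: emeasurable_funM => //; exact: measurable_partial.
  - apply: measurable_funeM; do 2 apply: emeasurable_funM => //; exact: mstep.
  - move=> w _; rewrite partialE !muleA lee_wpmul2r// lee_wpmul2r//.
    exact: kn.
(* The event that the increment lies in the whole circle has probability one, which bounds [L]. *)
have lo : (mass%:E * L <= (1 + e)%:E)%E.
  have <- : (\int[@circle_leb R]_x ((\1_[set: T] x) * p x)%:E = mass%:E)%E.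
    by rewrite -massE.1; apply: eq_integral => x _; rewrite indicT mul1r.
  have : nu (step @^-1` setT) = 1%E by rewrite preimage_setT; exact: probability_setT.
  rewrite -IC// first// => E1; rewrite -[(1 + e)%:E]mule1 -E1 -ge0_integralZl//; last 2 first.
  - by apply: emeasurable_funM => //; exact: measurable_partial.
  - by move=> w _; rewrite mule_ge0// partial_ge0.
  apply: ge0_le_integral => //.
  - by move=> w _; rewrite mule_ge0// mule_ge0.
  - by do 2 apply: emeasurable_funM => //; exact: mstep.
  - apply: measurable_funeM; apply: emeasurable_funM => //; exact: measurable_partial.
  - move=> w _; rewrite partialE !muleA lee_wpmul2r// lee_wpmul2r//.
    exact: kn.
have I0 : (0 <= \int[@circle_leb R]_x (\1_B x * p x)%:E)%E.
  by apply: integral_ge0 => x _; rewrite lee_fin mulr_ge0// p_ge0.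
apply: le_trans (lee_wpmul2r _ up) _; first by rewrite lee_fin ltW// mass_gt0.
rewrite expr2 EFinM -!muleA lee_wpmul2l// muleC [leRHS]muleC -!muleA muleCA.
by rewrite muleA [leRHS]muleC lee_wpmul2r.
Qed.

Lemma step_law B : measurable B ->
  (nu (step @^-1` B) * mass%:E <= \int[@circle_leb R]_x (\1_B x * p x)%:E)%E.
Proof.
move=> mB; have := fun e => @step_law_approx B e mB.
have : nu (step @^-1` B) \is a fin_num.
  apply: fin_num_measure; rewrite -[X in measurable X]setTI.
  exact: measurable_step.
case: (nu (step @^-1` B)) => [r| |]// _.
have : (\int[@circle_leb R]_x (\1_B x * p x)%:E <= mass%:E)%E.
  rewrite -massE.1; apply: ge0_le_integral => //.
  - by move=> x _; rewrite lee_fin mulr_ge0// p_ge0.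
  - by apply/measurable_EFinP/measurable_funM.
  - exact/measurable_EFinP.
  - by move=> x _; rewrite lee_fin ler_piMl ?p_ge0// indicE; case: (_ \in _).
have : (0 <= \int[@circle_leb R]_x (\1_B x * p x)%:E)%E.
  by apply: integral_ge0 => x _; rewrite lee_fin mulr_ge0// p_ge0.
case: (\int[_]_x _)%E => [i| |]//.
rewrite !lee_fin => i0 _ approx; apply/ler_addgt0Pr => d d0.
(* For [e <= 1] the square of [1 + e] is at most [1 + 3 * e], so the excess is at most
   [3 * e * i <= d]; the [+ 1] keeps the denominator positive. *)
pose e := Num.min 1 (d / (3 * (i + 1))).
have i1 : 0 < 3 * (i + 1) by lra.
have e0 : 0 < e by rewrite lt_min ltr01 divr_gt0.
have e1 : e <= 1 by rewrite ge_min lexx.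
have ed : e * (3 * (i + 1)) <= d by rewrite -ler_pdivlMr// ge_min lexx orbT.
have := approx e e0; rewrite -!EFinM lee_fin => /le_trans; apply.
have : e * e <= e by rewrite ler_piMl// ltW.
nra.
Qed.

End resampling.

Lemma gibbs_difference_law (R : realType) (U : circle R -> R) (K : R)
    (rho : probability (config R) R) (B : set (circle R)) :
  measurable_fun setT U -> (forall x, `|U x| <= K) ->
  gibbs_measure (nn_interaction U) rho -> measurable B ->
  (rho (@difference R @^-1` B) * \int[@circle_leb R]_x (expR (U x))%:E <=
   \int[@circle_leb R]_x (\1_B x * expR (U x))%:E)%E.
Proof.
move=> mU UK gibbs mB; pose p x := expR (U x).
have mp : measurable_fun setT p by exact: measurableT_comp.
have pc x : expR (- K) <= p x.
  by rewrite ler_expR; have := UK x; rewrite ler_norml => /andP[].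
have pM x : p x <= expR K.
  by rewrite ler_expR; have := UK x; rewrite ler_norml => /andP[].
have c0 : 0 < expR (- K) by exact: expR_gt0.
(* The identity pushes [rho] to the sigma-algebra generated by the coordinates, on which resampling
   is jointly measurable. *)
pose mid := isMeasurableFun.Build _ _ _ _ _ (@measurable_config_cyl R).
pose F : {mfun config R >-> cyl R} := HB.pack (id : config R -> cyl R) mid.
pose nu : probability (cyl R) R := distribution rho F.
have nuE A : nu A = rho A by [].
have dlr (k : int) (A : set (cyl R)) : measurable A ->
  nu A = (\int[nu]_w \int[@circle_leb R]_x
    (\1_A (upd w k x) *
      ((fine (site_norm p k w))^-1 * site p k (upd w k x)))%:E)%E.
  move=> mA.
  have mAc : measurable (A : set (config R)).
    by rewrite -[A]setTI; exact: (@measurable_config_cyl R).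
  (* With the whole space as outside event, the DLR equation says that the measure is invariant
     under the one-site kernel. *)
  have out : outside_sigma_algebra [fset k]%fset [set: config R].
    by rewrite -(setD0 setT); apply: sigma_algebraCD; exact: sigma_algebra0.
  have siteE w x : site p k (upd w k x) =
      expR (- hamiltonian (nn_interaction U) [fset k]%fset (dfwith w k x)).
    by rewrite hamiltonian_nn1 opprK expRD /site /bond subrK.
  have normE w : site_norm p k w =
      partition_function (nn_interaction U) [fset k]%fset w.
    rewrite /partition_function integral_sites1.
    by apply: eq_integral => x _ /=; rewrite siteE.
  have s0 w := @site_ge0 R p _ c0 pc k w.
  pose h (z : cyl R * circle R) := (\1_A (upd z.1 k z.2) *
      ((fine (site_norm p k z.1))^-1 * site p k (upd z.1 k z.2)))%:E.
  have h0 z : (0 <= h z)%E.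
    rewrite lee_fin /= mulr_ge0 ?indicE// mulr_ge0// invr_ge0 ltW//.
    by have [] := @site_norm_fin R p _ _ mp c0 pc pM k z.1.
  have mh : measurable_fun setT h.
    have mu := @measurable_upd R k.
    apply/measurable_EFinP; apply: measurable_funM.
      exact: (measurableT_comp (measurable_indic mA) mu).
    apply: measurable_funM; last exact: (measurableT_comp (measurable_site mp k) mu).
    apply: (measurableT_comp (f := fun w => (fine (site_norm p k w))^-1)) => //.
    apply: measurable_funV_gt0.
      apply: measurableT_comp => //.
      exact: (@measurable_site_norm R p (expR (- K))).
    by move=> w; have [] := @site_norm_fin R p _ _ mp c0 pc pM k w.
  rewrite nuE -(setIT A) (gibbs _ _ _ mAc out).
  rewrite setIT (@ge0_integral_pushforward _ _ _ _ R F (measurable_funPT F) rho setT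
    (fun w => \int[@circle_leb R]_x h (w, x))%E)//.
  - rewrite preimage_setT; apply: eq_integral => w _.
    rewrite /gibbs_kernel integral_sites1; apply: eq_integral => x _ /=.
    by rewrite -normE -siteE.
  - exact: (measurable_fun_fubini_tonelli_F h).
  - by move=> w _; apply: integral_ge0.
have := @step_law _ p _ _ mp c0 pc pM nu dlr B mB.
rewrite nuE /mass fineK//.
have [E _] := @massE R p _ _ mp c0 pc pM.
by rewrite E.
Qed.

(** * Smooth bumps *)

(** This criterion serves at the two places where calculus rules do not apply: [flat] at the origin,
    and termwise differentiation of a series. *)
Lemma is_derive_quadratic (R : realType) (f : R -> R) (x d C : R) :
  (forall y, `|f y - f x - d * (y - x)| <= C * (y - x) ^+ 2) ->
  is_derive x 1 f d.
Proof.
move=> fC; apply/is_derive1_caratheodory.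
pose g y := if y == x then d else (f y - f x) / (y - x).
exists g; split.
- move=> y; rewrite /g; case: eqP => [->|/eqP yx]; first by rewrite !subrr mulr0.
  by rewrite divfK// subr_eq0.
- have C0 : 0 <= C.
    have := fC (x + 1); have -> : x + 1 - x = 1 by ring.
    by rewrite expr1n !mulr1; apply: le_trans.
  have C1 : 0 < C + 1 by rewrite ltr_wpDl.
  apply/cvgrPdist_le => e e0; have eC0 : 0 < e / (C + 1) by exact: divr_gt0.
  near=> y.
  rewrite /g eqxx; case: eqP => [_|/eqP yx]; first by rewrite subrr normr0 ltW.
  have yx0 : y - x != 0 by rewrite subr_eq0.
  have -> : d - (f y - f x) / (y - x) = - ((f y - f x - d * (y - x)) / (y - x)).
    by field.
  rewrite normrN normrM normfV ler_pdivrMr ?normr_gt0//.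
  apply: le_trans (fC y) _; rewrite -real_normK ?num_real// expr2 mulrA.
  apply: ler_wpM2r => //.
  have : `|x - y| < e / (C + 1) by near: y; exact: (nbhsx_ballx x _ eC0).
  rewrite distrC ltr_pdivlMr// => /ltW; apply: le_trans.
  by rewrite mulrC ler_wpM2l// lerDl.
- by rewrite /g eqxx.
Unshelve. all: by end_near. Qed.

Section flat.
Variable R : realType.

(* For [n = 0] this is the standard smooth function vanishing on the negative
   half line; the whole family is closed under derivation. *)
Definition flat (n : nat) (x : R) : R :=
  if 0 < x then x ^- n * expR (- x^-1) else 0.

Lemma flat_ge0 n x : 0 <= flat n x.
Proof.
rewrite /flat; case: ltP => // x0.
by rewrite mulr_ge0 ?expR_ge0// invr_ge0 exprn_ge0// ltW.
Qed.

Lemma flat_le0 n x : x <= 0 -> flat n x = 0.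
Proof. by rewrite /flat leNgt => /negbTE ->. Qed.

Lemma flat_gt0 n x : 0 < x -> 0 < flat n x.
Proof.
by move=> x0; rewrite /flat x0 mulr_gt0 ?expR_gt0// invr_gt0 exprn_gt0.
Qed.

(** [t ^+ n] divided by the factorial of [n] is a single term of the exponential series. *)
Lemma exprn_expRN n (t : R) : 0 <= t -> t ^+ n * expR (- t) <= n`!%:R.
Proof.
move=> t0; rewrite expRN ler_pdivrMr ?expR_gt0//.
have n0 : 0 < n`!%:R :> R by rewrite ltr0n fact_gt0.
rewrite -ler_pdivrMl// mulrC; case: n n0 => [_|n n0].
  by rewrite expr0 fact0 divr1 -[1]addr0; apply: le_trans (expR_ge1Dx t); rewrite lerD2l.
by apply: le_trans (expR_ge1Dxn n t0); rewrite lerDr.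
Qed.

Lemma flat_le n x : flat n x <= n`!%:R.
Proof.
rewrite /flat; case: ltP => // x0.
by rewrite -exprVn exprn_expRN// invr_ge0 ltW.
Qed.

Lemma flat_mono x y : x <= y -> flat 0 x <= flat 0 y.
Proof.
move=> xy; rewrite {1}/flat; case: ltP => [x0|_]; last exact: flat_ge0.
have y0 : 0 < y by exact: lt_le_trans xy.
by rewrite /flat y0 !expr0 !invr1 !mul1r ler_expR lerN2 lef_pV2.
Qed.

(** For positive [x], [flat n x] is [x ^+ 2 * flat n.+2 x] with a bounded second factor. This is the
    quadratic remainder that gives derivative 0 at the origin. *)
Lemma flat_sqr n x : flat n x <= n.+2`!%:R * x ^+ 2.
Proof.
rewrite {1}/flat; case: ltP => x0; last by rewrite mulr_ge0// sqr_ge0.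
rewrite -ler_pdivrMr ?exprn_gt0// mulrAC -invfM -exprD addn2.
by rewrite -exprVn exprn_expRN// invr_ge0 ltW.
Qed.

Lemma is_derive_flat n (x : R) :
  is_derive x 1 (flat n) (flat n.+2 x - n%:R * flat n.+1 x).
Proof.
have [x0|x0|->] := ltgtP x 0.
- rewrite !flat_le0 ?ltW// mulr0 subr0.
  apply: (@near_eq_is_derive R R^o R^o (cst 0)).
  near=> y; rewrite flat_le0//; near: y.
  by apply: filterS (lt_nbhsl x0) => y /ltW.
- apply: (@near_eq_is_derive R R^o R^o (fun y => (y^-1) ^+ n * expR (- y^-1))).
    near=> y; rewrite /flat ifT ?exprVn//; near: y; exact: lt_nbhsr.
  have xn0 : x != 0 by rewrite gt_eqF.
  have dV : is_derive x 1 (fun y : R => y^-1) (- x ^- 2).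
    have := @is_deriveV R id x 1 1 xn0 (is_derive_id _ _).
    by rewrite [_%:A]mulr1.
  have dE : is_derive x 1 (fun y : R => expR (- y^-1)) (expR (- x^-1) * x ^- 2).
    apply: (@is_derive1_comp _ expR (fun y => - y^-1)).
    by rewrite -[x ^- 2]opprK; exact: is_deriveN.
  have dn : is_derive x 1 (fun y : R => y^-1 ^+ n) ((n%:R * x^-1 ^+ n.-1) * (- x ^- 2)).
    have := is_deriveX n dV.
    rewrite (_ : _ ^+ n = (fun y : R => y^-1 ^+ n))//.
    by apply/funext => y; rewrite exprfctE.
  have -> : flat n.+2 x - n%:R * flat n.+1 x =
      x^-1 ^+ n *: (expR (- x^-1) * x ^- 2) +
      expR (- x^-1) *: ((n%:R * x^-1 ^+ n.-1) * (- x ^- 2)).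
    rewrite /flat x0 /GRing.scale /= -!exprVn.
    case: (n) => [|k] /=; rewrite ?exprS; ring.
  exact: is_deriveM dn dE.
- rewrite !flat_le0// mulr0 subr0.
  apply: (@is_derive_quadratic _ _ _ _ (n.+2`!%:R)) => y.
  rewrite (@flat_le0 n 0)// subr0 mul0r !subr0 ger0_norm ?flat_ge0//.
  exact: flat_sqr.
Unshelve. all: by end_near. Qed.

(** The value of [flat 0 (z - 1 / 4)] at [z = 1], from which point on [top - flat 0 (z - 1 / 4)] is
    nonpositive. *)
Definition top : R := flat 0 (3 / 4).

Lemma top_gt0 : 0 < top.
Proof. by apply: flat_gt0; lra. Qed.

(* A smooth cut-off: since [flat 0] vanishes on the negative half line, [plateau]
   is constant on [z <= 1/4] and vanishes on [z >= 1]. *)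
Definition plateau (z : R) : R :=
  (flat 0 top)^-1 * flat 0 (top - flat 0 (z - 1 / 4)).

Let ftop0 : 0 < flat 0 top. Proof. exact/flat_gt0/top_gt0. Qed.

Lemma plateau1 z : z <= 1 / 4 -> plateau z = 1.
Proof.
move=> z4; rewrite /plateau (@flat_le0 0 (z - 1 / 4)) ?subr_le0//.
by rewrite subr0 mulVf// gt_eqF.
Qed.

Lemma plateau0 z : 1 <= z -> plateau z = 0.
Proof.
move=> z1; rewrite /plateau (@flat_le0 0 (top - _)) ?mulr0// subr_le0.
by apply: flat_mono; lra.
Qed.

Lemma plateau_ge0 z : 0 <= plateau z.
Proof. by rewrite mulr_ge0 ?flat_ge0// invr_ge0 ltW. Qed.

Lemma plateau_mono y z : y <= z -> plateau z <= plateau y.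
Proof.
move=> yz; apply: ler_wpM2l; first by rewrite invr_ge0 ltW.
apply: flat_mono; rewrite lerD2l lerN2.
by apply: flat_mono; rewrite lerD2r.
Qed.

Lemma plateau_le1 z : plateau z <= 1.
Proof.
have [z4|z4] := leP z (1 / 4); first by rewrite plateau1.
by rewrite -(@plateau1 (1 / 4))// plateau_mono// ltW.
Qed.

(* [true] selects the well at 0, [false] the well at 1/2. *)
Definition well (b : bool) (t : R) : R :=
  if b then sin (pi * t) ^+ 2 else cos (pi * t) ^+ 2.

Lemma well_itv b t : 0 <= well b t <= 1.
Proof.
have := cos2Dsin2 (pi * t); have := sqr_ge0 (sin (pi * t)).
by have := sqr_ge0 (cos (pi * t)); rewrite /well; case: b; lra.
Qed.

(* Functions of a scale [l] and a variable [t], closed under derivation in [t]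
   and with polynomial growth in [l]. *)
Inductive amplitude : (R -> R -> R) -> Prop :=
| Acst k : amplitude (fun _ _ => k)
| Alam : amplitude (fun l _ => l)
| Asin : amplitude (fun _ t => sin (pi * t))
| Acos : amplitude (fun _ t => cos (pi * t))
| Ainner n b : amplitude (fun l t => flat n (l * well b t - 1 / 4))
| Aouter n b :
    amplitude (fun l t => flat n (top - flat 0 (l * well b t - 1 / 4)))
| Aadd f g : amplitude f -> amplitude g -> amplitude (fun l t => f l t + g l t)
| Amul f g : amplitude f -> amplitude g -> amplitude (fun l t => f l t * g l t).

(** Among the generators only [l] is unbounded; [1 <= l] allows the larger exponent to absorb the
    smaller one in sums. *)
Lemma amplitude_bound f : amplitude f -> exists C N, 0 <= C /\
  forall l t, 1 <= l -> `|f l t| <= C * l ^+ N.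
Proof.
elim => [k| | | |n b|n b|g h _ [C [N [C0 gC]]] _ [D [P [D0 hD]]]
  |g h _ [C [N [C0 gC]]] _ [D [P [D0 hD]]]].
- by exists `|k|, 0%N; split=> // l t _; rewrite expr0 mulr1.
- exists 1, 1%N; split=> // l t l1; rewrite expr1 mul1r ger0_norm//.
  exact: le_trans l1.
- by exists 1, 0%N; split=> // l t l1; rewrite expr0 mulr1 sin_max.
- by exists 1, 0%N; split=> // l t l1; rewrite expr0 mulr1 cos_max.
- exists n`!%:R, 0%N; split=> // l t l1.
  by rewrite expr0 mulr1 ger0_norm ?flat_ge0// flat_le.
- exists n`!%:R, 0%N; split=> // l t l1.
  by rewrite expr0 mulr1 ger0_norm ?flat_ge0// flat_le.
- exists (C + D), (N + P)%N; split=> [|l t l1]; first exact: addr_ge0.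
  apply: le_trans (ler_normD _ _) _; rewrite mulrDl; apply: lerD.
    apply: le_trans (gC l t l1) _; apply: ler_wpM2l => //.
    by rewrite ler_weXn2l// leq_addr.
  apply: le_trans (hD l t l1) _; apply: ler_wpM2l => //.
  by rewrite ler_weXn2l// leq_addl.
- exists (C * D), (N + P)%N; split=> [|l t l1]; first exact: mulr_ge0.
  rewrite normrM exprD mulrACA; apply: ler_pM => //; [exact: gC|exact: hD].
Qed.

Lemma is_derive_sinpi (t : R) :
  is_derive t 1 (fun t => sin (pi * t)) (pi * cos (pi * t)).
Proof.
have dpi : is_derive t 1 (fun t : R => pi * t) pi.
  have := is_deriveZ pi (is_derive_id t (1 : R)).
  by rewrite [_ *: 1]mulr1.
by rewrite mulrC; apply: (@is_derive1_comp _ (@sin R) (fun t => pi * t)).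
Qed.

Lemma is_derive_cospi (t : R) :
  is_derive t 1 (fun t => cos (pi * t)) (- (pi * sin (pi * t))).
Proof.
have dpi : is_derive t 1 (fun t : R => pi * t) pi.
  have := is_deriveZ pi (is_derive_id t (1 : R)).
  by rewrite [_ *: 1]mulr1.
by rewrite mulrC -mulNr; apply: (@is_derive1_comp _ (@cos R) (fun t => pi * t)).
Qed.

Lemma is_derive_mul (f g : R -> R) (t df dg : R) :
  is_derive t 1 f df -> is_derive t 1 g dg ->
  is_derive t 1 (fun t => f t * g t) (f t * dg + g t * df).
Proof. exact: is_deriveM. Qed.

Lemma is_derive_add (f g : R -> R) (t df dg : R) :
  is_derive t 1 f df -> is_derive t 1 g dg ->
  is_derive t 1 (fun t => f t + g t) (df + dg).
Proof. exact: is_deriveD. Qed.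

Lemma is_derive_well b (t : R) : is_derive t 1 (well b)
  ((if b then 1 else -1) * (2 * pi * (sin (pi * t) * cos (pi * t)))).
Proof.
case: b; rewrite /well.
  have := is_derive_mul (is_derive_sinpi t) (is_derive_sinpi t).
  by under eq_fun do rewrite -expr2; move=> h; apply: (is_derive_eq h); ring.
have := is_derive_mul (is_derive_cospi t) (is_derive_cospi t).
by under eq_fun do rewrite -expr2; move=> h; apply: (is_derive_eq h); ring.
Qed.

Lemma is_derive_scaled b (l t : R) :
  is_derive t 1 (fun t => l * well b t - 1 / 4)
  ((if b then 1 else -1) * (2 * pi * (sin (pi * t) * cos (pi * t))) * l).
Proof.
have := is_derive_add (is_deriveZ l (is_derive_well b t))
  (is_derive_cst (- (1 / 4) : R) t 1).
by move=> h; apply: (is_derive_eq h); rewrite addr0 /GRing.scale/= mulrC.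
Qed.

Lemma amplitude_derive f : amplitude f -> exists2 g, amplitude g &
  forall l t : R, is_derive t 1 (f l) (g l t).
Proof.
have Ascaled b : amplitude (fun l t =>
    (if b then 1 else -1) * (2 * pi * (sin (pi * t) * cos (pi * t))) * l).
  apply: Amul; last exact: Alam.
  apply: (Amul (Acst _)); apply: (Amul (Acst _)).
  by apply: Amul; [exact: Asin|exact: Acos].
elim => [k| | | |n b|n b|g h _ [g' ag dg] _ [h' ah dh]
  |g h ag0 [g' ag dg] ah0 [h' ah dh]].
- by exists (fun _ _ => 0) => [|l t]; [exact: Acst|exact: is_derive_cst].
- by exists (fun _ _ => 0) => [|l t]; [exact: Acst|exact: is_derive_cst].
- exists (fun _ t => pi * cos (pi * t)) => [|l t]; last exact: is_derive_sinpi.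
  by apply: Amul; [exact: Acst|exact: Acos].
- exists (fun _ t => (- pi) * sin (pi * t)) => [|l t].
    by apply: Amul; [exact: Acst|exact: Asin].
  by rewrite mulNr; exact: is_derive_cospi.
- exists (fun l t => (flat n.+2 (l * well b t - 1 / 4) +
      (- n%:R) * flat n.+1 (l * well b t - 1 / 4)) *
      ((if b then 1 else -1) * (2 * pi * (sin (pi * t) * cos (pi * t))) * l)).
    apply: Amul; last exact: Ascaled.
    apply: Aadd; first exact: Ainner.
    by apply: Amul; [exact: Acst|exact: Ainner].
  move=> l t; rewrite mulNr.
  apply: (@is_derive1_comp _ (flat n) (fun t => l * well b t - 1 / 4)).
    exact: is_derive_flat.
  exact: is_derive_scaled.
- exists (fun l t => (flat n.+2 (top - flat 0 (l * well b t - 1 / 4)) +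
      (- n%:R) * flat n.+1 (top - flat 0 (l * well b t - 1 / 4))) *
      ((- 1) * (flat 2 (l * well b t - 1 / 4) *
      ((if b then 1 else -1) * (2 * pi * (sin (pi * t) * cos (pi * t))) * l)))).
    apply: Amul.
      apply: Aadd; first exact: Aouter.
      by apply: Amul; [exact: Acst|exact: Aouter].
    apply: (Amul (Acst _)); apply: Amul; [exact: Ainner|exact: Ascaled].
  move=> l t; rewrite mulNr.
  apply: (@is_derive1_comp _ (flat n)
    (fun t => top - flat 0 (l * well b t - 1 / 4))).
    exact: is_derive_flat.
  have d0 : is_derive t 1 (fun t => flat 0 (l * well b t - 1 / 4))
      (flat 2 (l * well b t - 1 / 4) *
      ((if b then 1 else -1) * (2 * pi * (sin (pi * t) * cos (pi * t))) * l)).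
    apply: (@is_derive1_comp _ (flat 0) (fun t => l * well b t - 1 / 4)).
      by have := is_derive_flat 0 (l * well b t - 1 / 4); rewrite mul0r subr0.
    exact: is_derive_scaled.
  have := is_derive_add (is_derive_cst (top : R) t 1) (is_deriveN d0).
  by rewrite add0r mulN1r.
- exists (fun l t => g' l t + h' l t) => [|l t]; first exact: Aadd.
  exact: is_derive_add.
- exists (fun l t => g l t * h' l t + h l t * g' l t) => [|l t].
    by apply: Aadd; apply: Amul.
  exact: is_derive_mul.
Qed.

Lemma plateau_derivatives b : exists D : nat -> R -> R -> R, [/\
  forall l t, D 0 l t = plateau (l * well b t),
  forall k (l t : R), is_derive t 1 (D k l) (D k.+1 l t) &
  forall k, exists C N, 0 <= C /\ forall l t, 1 <= l -> `|D k l t| <= C * l ^+ N].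
Proof.
(* The implication under the existential makes the choice total, with an arbitrary value off the
   amplitudes, so that the resulting map can be iterated. *)
have step : forall f, exists g, amplitude f -> amplitude g /\
    forall l t : R, is_derive t 1 (f l) (g l t).
  move=> f; have [af|naf] := pselect (amplitude f); last by exists f.
  by have [g] := amplitude_derive af; exists g.
have [der derP] := choice step.
pose f0 l t := plateau (l * well b t).
have a0 : amplitude f0 by apply: Amul; [exact: Acst|exact: Aouter].
have aD k : amplitude (iter k der f0).
  by elim: k => //= k /derP[].
exists (fun k => iter k der f0); split=> // k; last exact: amplitude_bound.
by move=> l t; have [_] := derP _ (aD k); exact.
Qed.

End flat.

(** * Dominated series *)

Section dominated_series.
Variable R : realType.
Implicit Types (a b : nat -> R) (B : R).

Definition sum_series a : R := limn (series a).

Definition dominated a B := forall j, `|a j| <= B * 2^-1 ^+ j.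

Lemma dominated_cvg a B : dominated a B -> cvgn (series a).
Proof.
move=> aB; apply: normed_cvg; apply: (series_le_cvg _ _ aB) => //.
- by move=> j; exact: le_trans (aB j).
- by apply: is_cvg_geometric_series; rewrite ger0_norm// invf_lt1// ltr1n.
Qed.

Lemma sum_half (B : R) m n : (m <= n)%N ->
  \sum_(m <= j < n) B * 2^-1 ^+ j = 2 * B * (2^-1 ^+ m - 2^-1 ^+ n).
Proof.
move=> mn; rewrite -(subnK mn) addnC; elim: (n - m)%N => [|k IH].
  by rewrite addn0 big_geq// subrr mulr0.
by rewrite addnS big_nat_recr ?leq_addr//= IH exprS; field.
Qed.

Lemma sum_series_tail a B N : dominated a B ->
  (forall j, (j < N)%N -> a j = 0) -> `|sum_series a| <= 2 * B * 2^-1 ^+ N.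
Proof.
move=> aB a0; have ca := dominated_cvg aB.
have B0 : 0 <= B by have := aB 0%N; rewrite expr0 mulr1; apply: le_trans.
have bnd n : `|series a n| <= 2 * B * 2^-1 ^+ N.
  rewrite seriesEnat /=; have [nN|/ltnW Nn] := leqP n N.
    rewrite big_nat_cond big1 ?normr0 ?mulr_ge0 ?exprn_ge0//.
    by move=> j /andP[/andP[_ jn] _]; apply: a0; exact: leq_trans nN.
  rewrite (big_cat_nat (n := N))//= big_nat_cond big1 ?add0r; last first.
    by move=> j /andP[/andP[_ jn] _]; exact: a0.
  apply: le_trans (ler_norm_sum _ _ _) _.
  apply: (@le_trans _ _ (\sum_(N <= j < n) B * 2^-1 ^+ j)).
    by apply: ler_sum => j _; exact: aB.
  by rewrite sum_half// ler_wpM2l ?mulr_ge0// lerBlDr lerDl exprn_ge0.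
rewrite ler_norml; apply/andP; split.
  by apply: limr_ge => //; apply: nearW => n; have := bnd n; rewrite ler_norml => /andP[].
by apply: limr_le => //; apply: nearW => n; have := bnd n; rewrite ler_norml => /andP[].
Qed.

Lemma sum_series_le a B : dominated a B -> `|sum_series a| <= 2 * B.
Proof. by move=> /sum_series_tail -/(_ 0%N); rewrite expr0 mulr1; apply. Qed.

Lemma sum_seriesD a b A B : dominated a A -> dominated b B ->
  sum_series (fun j => a j + b j) = sum_series a + sum_series b.
Proof.
move=> /dominated_cvg ca /dominated_cvg cb; rewrite /sum_series -limD//.
by congr (limn _); apply/funext => n; rewrite /series /= fctE big_split.
Qed.

Lemma sum_seriesZ a k B : dominated a B ->
  sum_series (fun j => k * a j) = k * sum_series a.
Proof.
move=> /dominated_cvg ca; rewrite /sum_series -[RHS](lim_seriesZ k ca).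
by [].
Qed.

Lemma ge0_sum_series a B N tau : dominated a B -> (forall j, 0 <= a j) ->
  (forall n, (N <= n)%N -> \sum_(N <= j < n) a j <= tau) ->
  series a N <= sum_series a <= series a N + tau.
Proof.
move=> aB a0 atau; have ca := dominated_cvg aB.
have nd : nondecreasing_seq (series a).
  by apply/nondecreasing_seqP => n; rewrite seriesSr lerDl.
apply/andP; split; first exact: nondecreasing_cvgn_le.
apply: limr_le => //; near=> n.
have Nn : (N <= n)%N by near: n; exists N.
rewrite [X in X <= _]/series /= (big_cat_nat (n := N))//=.
by rewrite lerD2l atau.
Unshelve. all: by end_near. Qed.

Lemma MVT_between (f df : R -> R) (x y : R) :
  (forall t : R, is_derive t 1 f (df t)) ->
  exists2 c, `|c - x| <= `|y - x| & f y - f x = df c * (y - x).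
Proof.
move=> fd.
have cf : continuous f.
  by move=> t; apply/differentiable_continuous/derivable1_diffP; have [] := fd t.
have [xy|yx] := leP x y.
  have [c + ->] := @MVT_segment _ f df x y xy (fun t _ => fd t) (continuous_subspaceT cf).
  by rewrite in_itv /= => /andP[xc cy]; exists c => //; rewrite !ger0_norm; lra.
have [c + E] := @MVT_segment _ f df y x (ltW yx) (fun t _ => fd t) (continuous_subspaceT cf).
rewrite in_itv /= => /andP[yc cx]; exists c; last by lra.
by rewrite !ler0_norm; lra.
Qed.

Lemma Taylor1 (f df ddf : R -> R) (M x y : R) :
  (forall t : R, is_derive t 1 f (df t)) ->
  (forall t : R, is_derive t 1 df (ddf t)) ->
  (forall t, `|ddf t| <= M) ->
  `|f y - f x - df x * (y - x)| <= M * (y - x) ^+ 2.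
Proof.
move=> fd dfd dM; have [c cx ->] := MVT_between x y fd.
have [c' _ E] := MVT_between x c dfd.
rewrite -mulrBl E -real_normK ?num_real// !normrM expr2 mulrA ler_wpM2r//.
by rewrite ler_pM.
Qed.

(** The Taylor remainders of the terms, controlled by the second derivatives, form a dominated
    series themselves; their sum is the quadratic remainder required by [is_derive_quadratic]. *)
Lemma is_derive_series (u : nat -> nat -> R -> R) (B : nat -> R) :
  (forall j k (t : R), is_derive t 1 (u j k) (u j k.+1 t)) ->
  (forall k t, dominated (fun j => u j k t) (B k)) ->
  forall k (t : R), is_derive t 1 (fun t => sum_series (fun j => u j k t))
    (sum_series (fun j => u j k.+1 t)).
Proof.
move=> ud uB k t; apply: (@is_derive_quadratic _ _ _ _ (2 * B k.+2)) => y.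
have domN a A : dominated a A -> dominated (fun j => -1 * a j) A.
  by move=> aA j; rewrite mulN1r normrN.
have domZ a A (z : R) : dominated a A -> dominated (fun j => z * a j) (`|z| * A).
  by move=> aA j; rewrite normrM -mulrA ler_wpM2l.
have domD a b A A' : dominated a A -> dominated b A' ->
    dominated (fun j => a j + b j) (A + A').
  by move=> aA bA j; rewrite mulrDl; apply: le_trans (ler_normD _ _) (lerD _ _).
have E : sum_series (fun j => u j k y) - sum_series (fun j => u j k t) -
    sum_series (fun j => u j k.+1 t) * (y - t) =
    sum_series (fun j => u j k y + -1 * u j k t + (t - y) * u j k.+1 t).
  rewrite (sum_seriesD (domD _ _ _ _ (uB k y) (domN _ _ (uB k t))) (domZ _ _ _ (uB k.+1 t))).
  rewrite (sum_seriesD (uB k y) (domN _ _ (uB k t))).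
  by rewrite (sum_seriesZ _ (uB k t)) (sum_seriesZ _ (uB k.+1 t)); ring.
rewrite E -mulrA; apply: sum_series_le => j.
rewrite mulrAC; have -> : u j k y + -1 * u j k t + (t - y) * u j k.+1 t =
  u j k y - u j k t - u j k.+1 t * (y - t) by ring.
exact: (Taylor1 _ _ (ud j k) (ud j k.+1) (fun s => uB k.+2 s j)).
Qed.

End dominated_series.

(** * The family of potentials *)

Section potential.
Variable R : realType.

(** With m = [j + 1] this is 2^(m+10) / beta_m. *)
Definition energy (j : nat) : R := 2 ^- ((j + 11) ^ 3 - (j + 11)).

(* The bump of index [j], i.e. of scale m = j + 1, has width 2^-(m+1)^2 at the
   preferred site and is narrower by a factor 2^-(m+3) at the other one; [lam] is
   the inverse square of the width. *)
Definition lam_exp (b : bool) (j : nat) : nat :=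
  2 * (j + 2) ^ 2 + (if b then 0 else 2 * (j + 4)).

Definition lam (b : bool) (j : nat) : R := 2 ^+ lam_exp b j.

Lemma energy_gt0 j : 0 < energy j.
Proof. by rewrite invr_gt0 exprn_gt0. Qed.

Lemma lam_gt0 b j : 0 < lam b j.
Proof. by rewrite exprn_gt0. Qed.

Lemma lam_ge1 b j : 1 <= lam b j.
Proof. by rewrite exprn_ege1// ler1n. Qed.

Lemma energy_lam_le (N : nat) : exists C : R, 0 <= C /\ forall b j,
  energy j * lam b j ^+ N <= C * 2^-1 ^+ j.
Proof.
(* The exponent of [energy] is cubic in [j] and that of [lam] quadratic; [K] pays for the finitely
   many [j] with [j + 11 <= 2 * N], where the cubic term may not yet dominate. *)
pose K := (8 * N ^ 3 + 2 * N)%N; exists (2 ^+ K); split=> [|b j].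
  by rewrite exprn_ge0.
rewrite /energy /lam -exprM exprVn ler_pdivlMr ?exprn_gt0// -mulrA mulrC.
rewrite ler_pdivrMr ?exprn_gt0// -!exprD ler_eXn2l ?ltr1n//.
have h1 : (lam_exp b j <= 2 * (j + 11) ^ 2)%N.
  by rewrite /lam_exp; case: b; rewrite !expnS !expn0; nia.
have : (lam_exp b j * N <= 2 * (j + 11) ^ 2 * N)%N by rewrite leq_mul2r h1 orbT.
have [xN|xN] := leqP (j + 11) (2 * N).
  have : (2 * (j + 11) ^ 2 * N <= 8 * N ^ 3)%N.
    by rewrite !expnS !expn0; nia.
  by rewrite /K; lia.
have : (2 * (j + 11) ^ 2 * N + 2 * (j + 11) <= (j + 11) ^ 3)%N.
  rewrite !expnS !expn0; nia.
by lia.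
Qed.

Definition bump_deriv (b : bool) : nat -> R -> R -> R :=
  projT1 (cid (plateau_derivatives R b)).

Lemma bump_derivP b : [/\
  forall l t, bump_deriv b 0 l t = plateau (l * well b t),
  forall k (l t : R),
    is_derive t 1 (bump_deriv b k l) (bump_deriv b k.+1 l t) &
  forall k, exists C N, 0 <= C /\
    forall l t, 1 <= l -> `|bump_deriv b k l t| <= C * l ^+ N].
Proof. by rewrite /bump_deriv; case: cid. Qed.

Definition pot_term (s : nat -> bool) (j k : nat) (t : R) : R :=
  energy j * (bump_deriv true k (lam (s j) j) t +
              bump_deriv false k (lam (~~ s j) j) t).

(** Uniformity in [t] gives smoothness of the sum, uniformity in [s] its continuity on the Cantor
    space. *)
Lemma pot_term_bound k : exists B, 0 <= B /\ forall s t,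
  dominated (fun j => pot_term s j k t) B.
Proof.
have [_ _ /(_ k)[C1 [N1 [C10 h1]]]] := bump_derivP true.
have [_ _ /(_ k)[C2 [N2 [C20 h2]]]] := bump_derivP false.
have [D1 [D10 d1]] := energy_lam_le N1.
have [D2 [D20 d2]] := energy_lam_le N2.
exists (C1 * D1 + C2 * D2); split=> [|s t j].
  by rewrite addr_ge0// mulr_ge0.
rewrite /pot_term normrM gtr0_norm ?energy_gt0//.
apply: le_trans (ler_wpM2l (ltW (energy_gt0 j)) (ler_normD _ _)) _.
rewrite mulrDr [leRHS]mulrDl; apply: lerD.
  apply: le_trans (ler_wpM2l (ltW (energy_gt0 j)) (h1 _ t (lam_ge1 _ _))) _.
  by rewrite mulrCA -mulrA ler_wpM2l.
apply: le_trans (ler_wpM2l (ltW (energy_gt0 j)) (h2 _ t (lam_ge1 _ _))) _.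
by rewrite mulrCA -mulrA ler_wpM2l.
Qed.

Lemma is_derive_pot_term s j k (t : R) :
  is_derive t 1 (pot_term s j k) (pot_term s j k.+1 t).
Proof.
have [_ /(_ k (lam (s j) j) t) h1 _] := bump_derivP true.
have [_ /(_ k (lam (~~ s j) j) t) h2 _] := bump_derivP false.
have := is_deriveZ (energy j) (is_derive_add h1 h2).
by [].
Qed.

Definition pot (s : nat -> bool) (k : nat) (t : R) : R :=
  sum_series (fun j => pot_term s j k t).

Lemma is_derive_pot s k (t : R) : is_derive t 1 (pot s k) (pot s k.+1 t).
Proof.
have [B BP] := choice pot_term_bound.
apply: (@is_derive_series _ (pot_term s) B) => [j k' t'|k' t'].
  exact: is_derive_pot_term.
by have [_] := BP k'; exact.
Qed.

Lemma derive1n_pot s k : derive1n k (pot s 0) = pot s k.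
Proof.
elim: k => // k IH; rewrite derive1nS IH; apply/funext => t.
by rewrite derive1E; have [] := is_derive_pot s k t.
Qed.

Lemma wellD1 b t : well b (t + 1) = well b t :> R.
Proof.
by rewrite /well mulrDr mulr1 sinDpi cosDpi !sqrrN.
Qed.

Lemma wellDz b (t : R) (n : int) : well b (t + n%:~R) = well b t.
Proof.
have wn (k : nat) u : well b (u + k%:R) = well b u :> R.
  elim: k u => [|k IH] u; first by rewrite addr0.
  by rewrite -natr1 addrA wellD1 IH.
case: n => n; first exact: wn.
by rewrite NegzE mulrNz -[in RHS](subrK n.+1%:R t) wn.
Qed.

Lemma bump0E b l t : bump_deriv b 0 l t = plateau (l * well b t).
Proof. by have [] := bump_derivP b. Qed.

Lemma pot0E s t : pot s 0 t = sum_series (fun j => energy j *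
  (plateau (lam (s j) j * well true t) + plateau (lam (~~ s j) j * well false t))).
Proof.
by congr (sum_series _); apply/funext => j; rewrite /pot_term !bump0E.
Qed.

Lemma pot0Dz s t (n : int) : pot s 0 (t + n%:~R) = pot s 0 t.
Proof. by rewrite !pot0E; congr (sum_series _); apply/funext => j; rewrite !wellDz. Qed.

Lemma wellDhalf b t : well b (t + 2^-1) = well (~~ b) t :> R.
Proof.
by rewrite /well !(mulrDr pi t) sinDpihalf cosDpihalf sqrrN; case: b.
Qed.

(** A half turn exchanges the wells, which amounts to flipping all signs. This symmetry reduces the
    sign - to the sign +. *)
Lemma pot0Dhalf s t : pot s 0 (t + 2^-1) = pot (fun j => ~~ s j) 0 t.
Proof.
rewrite !pot0E; congr (sum_series _); apply/funext => j.
by rewrite !wellDhalf negbK addrC.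
Qed.

Definition potential (s : nat -> bool) (x : circle R) : R := pot s 0 (csec x).

Lemma lift_potential s : circle_lift (potential s) = pot s 0.
Proof.
apply/funext => t; rewrite /circle_lift /= /potential.
have /to_circle_eq /intrP[n tn] := csecK (to_circle t).
by rewrite -(subrK t (csec _)) tn addrC pot0Dz.
Qed.

Lemma smooth_potential s : smooth (potential s).
Proof.
move=> k t; rewrite lift_potential derive1n_pot.
by have [] := is_derive_pot s k t.
Qed.

Definition smooth_pot (s : cantor_space) : Cinfty R :=
  Build_Cinfty (@smooth_potential s).

Lemma pot_close s s' k B N t : (forall s t, dominated (fun j => pot_term s j k t) B) ->
  (forall j, (j < N)%N -> s j = s' j) ->
  `|pot s k t - pot s' k t| <= 4 * B * 2^-1 ^+ N.
Proof.
move=> dB ss'.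
have dN : dominated (fun j => -1 * pot_term s' j k t) B.
  by move=> j; rewrite mulN1r normrN; exact: dB.
rewrite -mulN1r -(sum_seriesZ _ (dB s' t)) -(sum_seriesD (dB s t) dN).
have -> : 4 * B = 2 * (B + B) by ring.
apply: sum_series_tail => [j|j jN].
  by rewrite mulrDl; apply: le_trans (ler_normD _ _) (lerD (dB _ _ _) (dN _)).
by rewrite /pot_term ss'// mulN1r subrr.
Qed.

Lemma cantor_near (s : cantor_space) N :
  \forall s' \near s, forall j, (j < N)%N -> s j = s' j.
Proof.
elim: N => [|N IH]; first by apply: (@filterE _ (nbhs s)).
have h : \forall s' \near s, s N = s' N.
  have := @proj_continuous nat (fun=> bool) N s.
  move=> /(_ [set b | s N = b]); apply.
  by apply: open_nbhs_nbhs; split => //; exact: discrete_open.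
near=> s' => j; rewrite ltnS leq_eqVlt => /predU1P[->|].
  by near: s'.
by move: j; near: s'.
Unshelve. all: by end_near. Qed.

(** The initial and product topologies reduce the claim to one order of derivation at a time.
    Sequences that share their first [N] signs share the first [N] terms, and the tails are of order
    2^-N uniformly in [t]. *)
Lemma continuous_smooth_pot : continuous smooth_pot.
Proof.
have cont k : continuous (fun s : cantor_space => pot s k : {uniform R -> R}).
  have [B [B0 dB]] := pot_term_bound k.
  move=> s Q /uniform_nbhs[E [+ EQ]]; rewrite -entourage_ballE => -[e /= e0 eE].
  have [N Ne] : exists N, 4 * B * 2^-1 ^+ N < e.
    have /cvg_geometric : `|2^-1 : R| < 1 by rewrite ger0_norm// invf_lt1// ltr1n.
    move=> /(_ (4 * B)) /cvgr0_norm_lt /(_ e e0)[N _ /(_ N (leqnn N))] NE.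
    by exists N; apply: le_lt_trans NE; exact: ler_norm.
  have := cantor_near s N; apply: filterS => s' ss'; apply: EQ => t _.
  by apply: eE; rewrite /ball /=; apply: le_lt_trans Ne; exact: pot_close.
apply: (@continuous_comp_initial _ _ _ (@jet R) smooth_pot) => s.
apply/cvg_sup => k.
apply: (@continuous_comp_initial _ _ _ (fun f : nat -> {uniform R -> R} => f k)
  (fun s => jet (smooth_pot s))) => s'.
rewrite (_ : _ \o _ = fun s : cantor_space => pot s k : {uniform R -> R}).
  exact: cont.
by apply/funext => r; rewrite /= /jet lift_potential derive1n_pot.
Qed.

End potential.

(** * Concentration of the density *)

Section trigonometric_bounds.
Variable R : realType.

Lemma sin_le_id (x : R) : 0 <= x -> sin x <= x.
Proof.
move=> x0; have [c _] := MVT_between 0 x (@is_derive_sin R).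
rewrite sin0 !subr0 => ->; rewrite -[leRHS]mul1r ler_wpM2r//; exact: cos_le1.
Qed.

(** The mean slopes on [[0, r * x]] and on [[r * x, x]] are values of the decreasing cosine at
    ordered points. *)
Lemma sin_concave (r x : R) : 0 <= r <= 1 -> 0 <= x <= pi ->
  r * sin x <= sin (r * x).
Proof.
move=> /andP[r0 r1] /andP[x0 xpi].
have rx0 : 0 <= r * x by rewrite mulr_ge0.
have rxx : r * x <= x by rewrite ler_piMl.
have csin : continuous (@sin R) by exact: continuous_sin.
have [c1 + E1] := MVT_segment rx0 (fun t _ => is_derive_sin t) (continuous_subspaceT csin).
have [c2 + E2] := MVT_segment rxx (fun t _ => is_derive_sin t) (continuous_subspaceT csin).
rewrite !in_itv /= => /andP[c2l c2r] /andP[c1l c1r].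
have cc : cos c2 <= cos c1.
  by rewrite leNgt ltr_cos ?in_itv /= -?leNgt; lra.
move: E1; rewrite sin0 !subr0 => E1.
have : sin (r * x) - r * sin x = (1 - r) * (r * x) * (cos c1 - cos c2).
  have -> : sin x = sin (r * x) + cos c2 * (x - r * x) by rewrite -E2; ring.
  by rewrite E1; ring.
have : 0 <= (1 - r) * (r * x) * (cos c1 - cos c2).
  by rewrite !mulr_ge0 ?subr_ge0.
lra.
Qed.

(** Jordan's inequality, the case [x = pi / 2] of concavity. *)
Lemma sinpi_ge (t : R) : 0 <= t <= 1 / 2 -> 2 * t <= sin (pi * t).
Proof.
move=> /andP[t0 t2]; have := @sin_concave (2 * t) (pi / 2).
rewrite sin_pihalf mulr1; have -> : 2 * t * (pi / 2) = pi * t by field.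
by apply; have := @pi_gt0 R; lra.
Qed.

Lemma sqr_sinpi_norm (t : R) : sin (pi * `|t|) ^+ 2 = sin (pi * t) ^+ 2.
Proof.
by have [t0|t0] := ger0P t => //; rewrite mulrN sinN sqrrN.
Qed.

Lemma sqr_sinpi_ge (t : R) : `|t| <= 1 / 2 -> (2 * t) ^+ 2 <= sin (pi * t) ^+ 2.
Proof.
move=> t2; rewrite -sqr_sinpi_norm -[leLHS]real_normK ?num_real// normrM.
rewrite (ger0_norm (ler0n R 2)) ler_sqr ?nnegrE ?mulr_ge0//.
  by apply: sinpi_ge; rewrite normr_ge0.
apply: sin_ge0_pi; rewrite mulr_ge0 ?pi_ge0//= ler_piMr ?pi_ge0//; lra.
Qed.

(** The substitute for exact scaling of squared distances when narrow bumps are compared with wide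
    ones. *)
Lemma sqr_sinpi_scale (r t : R) : 0 <= r <= 1 -> `|t| <= 1 / 2 ->
  r ^+ 2 * sin (pi * t) ^+ 2 <= sin (pi * (r * t)) ^+ 2.
Proof.
move=> r01 t2; rewrite -sqr_sinpi_norm -(sqr_sinpi_norm (r * t)) -exprMn.
have /andP[r0 r1] := r01.
rewrite normrM (ger0_norm r0) mulrCA.
have pit : 0 <= pi * `|t| <= pi.
  by rewrite mulr_ge0 ?pi_ge0//= ler_piMr ?pi_ge0//; lra.
rewrite ler_sqr ?nnegrE.
- exact: sin_concave.
- by rewrite mulr_ge0// sin_ge0_pi.
- apply: sin_ge0_pi; have /andP[p0 p1] := pit; rewrite mulr_ge0//=.
  by apply: le_trans p1; rewrite ler_piMl.
Qed.

Lemma sqr_sinpi_le (t : R) : 0 <= t <= 1 -> sin (pi * t) ^+ 2 <= (4 * t) ^+ 2.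
Proof.
move=> /andP[t0 t1]; have p4 : pi <= 4 :> R by have := @pihalf_lt2 R; lra.
have pt0 : 0 <= pi * t by rewrite mulr_ge0 ?pi_ge0.
rewrite ler_sqr ?nnegrE ?mulr_ge0//.
  apply: le_trans (sin_le_id pt0) _; exact: ler_wpM2r.
by apply: sin_ge0_pi; rewrite pt0 /= ler_piMr ?pi_ge0.
Qed.

Lemma well_false (t : R) : well false t = sin (pi * (t - 1 / 2)) ^+ 2.
Proof.
by rewrite /well -sqrrN -sinBpihalf; congr (sin _ ^+ 2); field.
Qed.

Lemma wellN b (t : R) : well b (- t) = well b t.
Proof. by rewrite /well mulrN sinN cosN sqrrN. Qed.

End trigonometric_bounds.

(** * The potential at the scales of a block *)

Section estimate.
Variable R : realType.
(** The scales m, ..., m' of a block are the indices [i <= j < N], where [i] is m - 1 and [N] is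
    m'. *)
Variables (s : nat -> bool) (i N : nat).
Local Notation energy := (@energy R).
Local Notation lam := (@lam R).

Definition height j (t : R) : R :=
  plateau (lam (s j) j * well true t) + plateau (lam (~~ s j) j * well false t).

Lemma lam_ge2 c j : 2 <= lam c j.
Proof. by rewrite /lam -{1}[2]expr1 ler_eXn2l ?ltr1n// /lam_exp; case: c; lia. Qed.

Lemma height_ge0 j t : 0 <= height j t.
Proof. by rewrite addr_ge0 ?plateau_ge0. Qed.

(** The two wells add up to 1 and [lam] is at least 2, so at each point one of the two bumps
    vanishes. *)
Lemma height_le1 j t : height j t <= 1.
Proof.
have wE : well true t + well false t = 1 :> R by rewrite /well addrC cos2Dsin2.
have w0 c : 0 <= well c t by have /andP[] := well_itv c t.
have l2 c : 2 <= lam c j := lam_ge2 c j.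
rewrite /height; have [wt|wt] := leP (1 / 2) (well true t).
  rewrite (@plateau0 _ (lam (s j) j * _)) ?add0r ?plateau_le1//.
  by have := ler_pM _ _ (l2 (s j)) wt; lra.
rewrite (@plateau0 _ (lam (~~ s j) j * _)) ?addr0 ?plateau_le1//.
have wf : 1 / 2 <= well false t by lra.
by have := ler_pM _ _ (l2 (~~ s j)) wf; lra.
Qed.

(** The largest possible contribution of the scales before the block. *)
Definition base : R := \sum_(0 <= j < i) energy j.
(** This is 1 / (2 beta_m'): times any beta of the block it is at most 1/2. *)
Definition slack : R := 2^-1 / 2 ^+ ((N + 10) ^ 3).

Lemma energy_tail n : (N <= n)%N -> \sum_(N <= j < n) energy j <= slack.
Proof.
(* Chosen so that the full geometric tail [2 * B * 2^-1 ^+ N] is exactly [slack]. *)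
move=> Nn; pose B : R := 2 ^+ N / (4 * 2 ^+ ((N + 10) ^ 3)).
apply: (@le_trans _ _ (\sum_(N <= j < n) B * 2^-1 ^+ j)).
  rewrite big_nat_cond [leRHS]big_nat_cond; apply: ler_sum => j /andP[/andP[Nj _] _].
  have -> : B * 2^-1 ^+ j = 2 ^+ N / 2 ^+ (2 + (N + 10) ^ 3 + j).
    by rewrite /B exprVn !exprD; field; rewrite !expf_neq0.
  rewrite /energy ler_pdivlMr ?exprn_gt0// mulrC ler_pdivrMr ?exprn_gt0//.
  rewrite -exprD ler_eXn2l ?ltr1n//.
  have [d ->] : exists d, j = (N + d)%N by exists (j - N)%N; rewrite subnKC.
  rewrite !expnS !expn0; nia.
have B0 : 0 <= B by rewrite divr_ge0 ?mulr_ge0 ?exprn_ge0.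
rewrite sum_half//; apply: (@le_trans _ _ (2 * B * 2^-1 ^+ N)).
  by rewrite ler_wpM2l ?mulr_ge0// gerBl exprn_ge0.
by rewrite /B /slack exprVn le_eqVlt; apply/orP; left; apply/eqP; field; rewrite !expf_neq0.
Qed.

Lemma pot_bounds t :
  \sum_(0 <= j < N) energy j * height j t <= pot s 0 t <=
  \sum_(0 <= j < N) energy j * height j t + slack.
Proof.
have [B [B0 dB]] := @pot_term_bound R 0.
have dom : dominated (fun j => energy j * height j t) B.
  by move=> j; have := dB s t j; rewrite /pot_term !bump0E.
rewrite pot0E; apply: (ge0_sum_series dom).
  by move=> j; rewrite mulr_ge0 ?height_ge0// ltW// energy_gt0.
move=> n Nn; apply: le_trans (energy_tail Nn); apply: ler_sum => j _.
by rewrite ler_piMr ?height_le1// ltW// energy_gt0.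
Qed.

(* The bumps of index between [i] and [N] around the preferred ([c = true]) and
   the other ([c = false]) site, as functions of the squared distance. *)
Definition middle (c : bool) (z : R) : R :=
  \sum_(i <= j < N) energy j * plateau (lam c j * z).

Lemma lam_true_mono j : (i <= j)%N -> lam true i <= lam true j.
Proof.
move=> ij; rewrite /lam ler_eXn2l ?ltr1n// /lam_exp !addn0 leq_mul2l /=.
by rewrite leq_sqr leq_add2r.
Qed.

Lemma middle_ge0 c z : 0 <= middle c z.
Proof.
by apply: sumr_ge0 => j _; rewrite mulr_ge0 ?plateau_ge0// ltW// energy_gt0.
Qed.

Lemma middle_true0 z : 1 <= lam true i * z -> middle true z = 0.
Proof.
move=> z1; have z0 : 0 <= z.
  by rewrite -(pmulr_rge0 _ (lam_gt0 R true i)) (le_trans _ z1).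
rewrite /middle big_nat_cond big1// => j /andP[/andP[ij _] _].
rewrite plateau0 ?mulr0//; apply: le_trans z1 _.
by rewrite ler_wpM2r// lam_true_mono.
Qed.

Definition narrowing : R := 2 ^- (i + 4).

(** The ratio of the widths at index [j] is 2^-(j+4), which decreases in [j]; the dilation that fits
    the first scale of the block therefore serves all of them. *)
Lemma lam_narrowing j : (i <= j)%N -> lam true j <= lam false j * narrowing ^+ 2.
Proof.
move=> ij; rewrite /narrowing -exprVn -exprM exprVn ler_pdivlMr ?exprn_gt0//.
by rewrite -exprD ler_eXn2l ?ltr1n// /lam_exp; lia.
Qed.

Lemma middle_scale z y : 0 <= z -> narrowing ^+ 2 * z <= y -> middle false y <= middle true z.
Proof.
move=> z0 zy; rewrite /middle big_nat_cond [leRHS]big_nat_cond.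
apply: ler_sum => j /andP[/andP[ij _] _].
rewrite ler_wpM2l ?(ltW (energy_gt0 _ _))//; apply: plateau_mono.
apply: le_trans (ler_wpM2l (ltW (lam_gt0 _ _ _)) zy).
by rewrite mulrA ler_wpM2r// lam_narrowing.
Qed.

Hypotheses (iN : (i < N)%N) (si : forall j, (i <= j < N)%N -> s j).

Lemma split_sum (f : nat -> R) : \sum_(0 <= j < N) f j =
  \sum_(0 <= j < i) f j + \sum_(i <= j < N) f j.
Proof. by rewrite (big_cat_nat (n := i))//= ltnW. Qed.

(** Away from the wide bump of index [i] all preferred bumps of the block vanish; only the narrow
    ones around 1/2 remain, besides the earlier and the later scales. *)
Lemma pot_upper t : 1 <= lam true i * well true t ->
  pot s 0 t <= base + slack + middle false (well false t).
Proof.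
move=> t1; have /andP[_] := pot_bounds t; move=> /le_trans; apply.
rewrite split_sum addrAC; apply: lerD.
  by rewrite lerD2r; apply: ler_sum => j _; rewrite ler_piMr ?height_le1// ltW// energy_gt0.
rewrite [leLHS]big_nat_cond /middle [leRHS]big_nat_cond.
apply: ler_sum => j /andP[/andP[ij jN] _].
rewrite ler_wpM2l ?(ltW (energy_gt0 _ _))// /height si ?ij//=.
rewrite (@plateau0 _ (lam true j * _)) ?add0r//; apply: le_trans t1 _.
by rewrite ler_wpM2r ?lam_true_mono//; have /andP[] := well_itv true t.
Qed.

Lemma pot_lower t : lam true i * well true t <= 1 ->
  base + middle true (well true t) <= pot s 0 t.
Proof.
move=> t1; have /andP[+ _] := pot_bounds t; apply: le_trans.
have w0 : 0 <= well true t by have /andP[] := well_itv true t.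
rewrite split_sum; apply: lerD.
  rewrite /base big_nat_cond [leRHS]big_nat_cond.
  apply: ler_sum => j /andP[/andP[_ ji] _].
  rewrite -[leLHS]mulr1 ler_wpM2l ?(ltW (energy_gt0 _ _))//.
  rewrite -[leLHS]addr0 /height lerD ?plateau_ge0// plateau1//.
  rewrite ler_pdivlMr// mulrC mulrA; apply: le_trans t1; rewrite ler_wpM2r//.
  (* An earlier bump at 0, wide or narrow, is at full height here because
     [4 * lam (s j) j <= lam true i]. This is an equality for a narrow bump with [j = 0] and
     [i = 1]. *)
  have -> : (4 : R) = 2 ^+ 2 by ring.
  rewrite /lam -exprD ler_eXn2l ?ltr1n// /lam_exp.
  by case: (s j); rewrite !expnS !expn0; nia.
rewrite [leRHS]big_nat_cond /middle [leLHS]big_nat_cond.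
apply: ler_sum => j /andP[/andP[ij jN] _].
rewrite ler_wpM2l ?(ltW (energy_gt0 _ _))// /height si ?ij//=.
by rewrite lerDl plateau_ge0.
Qed.

Lemma middle_true_ge z : lam true i * z <= 1 / 4 -> energy i <= middle true z.
Proof.
move=> z4; rewrite /middle big_ltn// plateau1// mulr1 lerDl.
by apply: sumr_ge0 => j _; rewrite mulr_ge0 ?plateau_ge0// ltW// energy_gt0.
Qed.

End estimate.

Section concentration.
Variable R : realType.
Local Notation T := (circle R).

Lemma continuous_pot s k : continuous (@pot R s k).
Proof.
move=> t; apply/differentiable_continuous/derivable1_diffP.
by have [] := is_derive_pot s k t.
Qed.

Lemma measurable_potential s : measurable_fun setT (@potential R s).
Proof.
apply: measurableT_comp (@measurable_csec R).
by apply: continuous_measurable_fun; exact: continuous_pot.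
Qed.

Lemma potential_bounded s : exists K, forall x, `|@potential R s x| <= K.
Proof.
have [B [_ dB]] := @pot_term_bound R 0.
by exists (2 * B) => x; apply: sum_series_le; exact: dB.
Qed.

Lemma measurable_plateau_well (l : R) c :
  measurable_fun setT (fun t : R => plateau (l * well c t)).
Proof.
rewrite (_ : (fun _ => _) = @bump_deriv R c 0 l); last first.
  by apply/funext => t; rewrite bump0E.
apply: continuous_measurable_fun => t.
apply/differentiable_continuous/derivable1_diffP.
by have [_ /(_ 0%N l t) [d _] _] := bump_derivP R c.
Qed.

Lemma measurable_middle i N c d :
  measurable_fun setT (fun t : R => middle i N c (well d t)).
Proof.
apply: measurable_sum => j; apply: measurable_funM; first exact: measurable_cst.
exact: measurable_plateau_well.
Qed.

Lemma well_csec c t : well c (csec (to_circle t)) = well c t :> R.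
Proof.
have /to_circle_eq /intrP[n tn] := csecK (to_circle t).
by rewrite -(subrK t (csec _)) tn addrC wellDz.
Qed.

Definition circle_arc (c d : R) : set T := @to_circle R @` `[c - d, c + d].

Lemma measurable_circle_arc c d : 0 <= d -> measurable (circle_arc c d).
Proof.
move=> d0; have m1 (t : R) : measurable [set to_circle t : T].
  rewrite (_ : [set to_circle t] = @csec R @^-1` [set csec (to_circle t)]).
    rewrite -[X in measurable X]setTI; exact: measurable_csec.
  by apply/seteqP; split=> [x /= ->//|x /= E]; rewrite -(csecK x) E csecK.
rewrite /circle_arc (_ : _ @` _ = [set to_circle (c - d) : T] `|`
    @to_circle R @` `]c - d, c + d[ `|` [set to_circle (c + d) : T]); last first.
  apply/seteqP; split=> [x [t + <-]|x].
    rewrite /= in_itv /= => /andP[]; rewrite le_eqVlt => /predU1P[<-|tl].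
      by left; left.
    rewrite le_eqVlt => /predU1P[->|tr]; first by right.
    by left; right; exists t => //=; rewrite in_itv /= tl.
  move=> [[->|[t + <-]]|->].
  - by exists (c - d) => //=; rewrite in_itv /=; lra.
  - by rewrite /= in_itv /= => /andP[tl tr]; exists t => //=; rewrite in_itv /= !ltW.
  - by exists (c + d) => //=; rewrite in_itv /=; lra.
apply: measurableU => //; apply: measurableU => //.
exact: measurable_to_circle_oo.
Qed.

Definition delta (i : nat) : R := 2 ^- ((i + 2) ^ 2).

Lemma delta_gt0 i : 0 < delta i.
Proof. by rewrite invr_gt0 exprn_gt0. Qed.

Lemma lam_delta i : lam R true i * delta i ^+ 2 = 1.
Proof.
rewrite /lam /lam_exp addn0 /delta -exprVn -exprM mulnC exprVn divff// expf_neq0.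
Qed.

(** Jordan's inequality, applied to whichever of [t] and [t - 1] lies within 1/2 of the origin. *)
Lemma outside_arc i t : t \in `[0, 1[ -> ~ circle_arc 0 (delta i) (to_circle t) ->
  1 <= lam R true i * well true t.
Proof.
rewrite in_itv /= => /andP[t0 t1] nK; rewrite -(lam_delta i) ler_wpM2l//.
  by rewrite ltW// lam_gt0.
have d0 := delta_gt0 i.
have close (u : R) : `|u| <= 1 / 2 -> to_circle u = to_circle t :> T ->
    delta i ^+ 2 <= sin (pi * u) ^+ 2.
  move=> u2 ut; apply: le_trans (sqr_sinpi_ge u2).
  rewrite -(real_normK (num_real (2 * u))) ler_sqr ?nnegrE ?(ltW d0)//.
  rewrite normrM (ger0_norm (ler0n R 2)); rewrite leNgt; apply/negP => ud.
  apply: nK; exists u => //=; rewrite in_itv /= sub0r add0r -ler_norml.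
  by have := normr_ge0 u; lra.
have [t2|t2] := leP t (1 / 2); first by apply: close => //; rewrite ger0_norm.
have -> : sin (pi * t) ^+ 2 = well true (t - 1).
  by rewrite -[LHS]/(well true t) -[t in LHS](subrK 1) wellD1.
apply: close; first by rewrite ler0_norm; lra.
exact: (to_circleDz t (-1)).
Qed.

Definition density (b : R) s (x : T) : \bar R := (expR (b * potential s x))%:E.

Lemma measurable_density b s : measurable_fun setT (density b s).
Proof.
apply/measurable_EFinP; apply: measurableT_comp => //.
by apply: measurable_funM => //; exact: measurable_potential.
Qed.

Lemma density_ge0 b s x : (0 <= density b s x)%E.
Proof. by rewrite lee_fin expR_ge0. Qed.

Lemma potentialE s t : potential s (to_circle t) = pot s 0 t :> R.
Proof. by rewrite -lift_potential. Qed.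

End concentration.

(** * Mass of the density outside the preferred arc *)

Section concentration_estimate.
Variable R : realType.
Local Notation T := (circle R).
Variables (s : nat -> bool) (i N : nat).
Hypotheses (iN : (i < N)%N) (si : forall j, (i <= j < N)%N -> s j).
Variable b : R.
Hypothesis bi : 2 ^+ ((i + 11) ^ 3) <= b.
Hypothesis bN : b <= 2 ^+ ((N + 10) ^ 3).

Local Notation base := (base R i).
Local Notation slack := (slack R N).
Local Notation middle := (@middle R i N).
Local Notation narrowing := (narrowing R i).
Local Notation delta := (delta R i).

Let b0 : 0 < b. Proof. by apply: lt_le_trans bi; rewrite exprn_gt0. Qed.
Let r0 : 0 < narrowing. Proof. by rewrite invr_gt0 exprn_gt0. Qed.
Let r1 : narrowing <= 1. Proof. by rewrite invf_le1 ?exprn_gt0// exprn_ege1// ler1n. Qed.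

(* The dilation by [narrowing^-1] centred at 1/2. *)
Let dil (t : R) : R := narrowing^-1 * t + (1 - narrowing^-1) / 2.

(** The wide bumps of the block transplanted to 1/2, so that the narrow bumps there can be compared
    with them by a dilation. *)
Definition profile (t : R) : R := expR (b * middle true (well false t)).

Lemma measurable_profile : measurable_fun setT profile.
Proof.
apply: measurableT_comp => //; apply: measurable_funM => //.
exact: measurable_middle.
Qed.

(** The 1 is the background level, where no bump of the block acts. When [dil t] leaves [[0, 1[],
    the point [t] is too far from 1/2 for any narrow bump. *)
Lemma pot_upper_dilated t : t \in `[0, 1[ -> ~ circle_arc 0 delta (to_circle t) ->
  expR (b * pot s 0 t) <= expR (b * (base + slack)) *
    (1 + if dil t \in `[0, 1[ then profile (dil t) else 0).
Proof.
move=> t01 tA; have up := pot_upper iN si (outside_arc t01 tA).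
apply: (@le_trans _ _ (expR (b * (base + slack)) *
    expR (b * middle false (well false t)))).
  by rewrite -expRD ler_expR -mulrDr ler_wpM2l// ltW.
rewrite ler_wpM2l ?expR_ge0//.
have tE : t - 1 / 2 = narrowing * (dil t - 1 / 2).
  by rewrite /dil; field; rewrite gt_eqF.
case: ifPn => [|dt].
  rewrite in_itv /= => /andP[d0 d1].
  apply: (@le_trans _ _ (profile (dil t))); last by rewrite lerDr.
  rewrite ler_expR ler_wpM2l ?(ltW b0)//; apply: middle_scale.
    by have /andP[] := well_itv false (dil t).
  rewrite -[leRHS]/(well false t) !well_false tE.
  apply: sqr_sinpi_scale; first by rewrite r1 ltW.
  by rewrite ler_norml; lra.
suff -> : middle false (well false t) = 0 by rewrite mulr0 expR0 addr0.
apply/eqP; rewrite eq_le middle_ge0 andbT.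
have w0 : 0 <= well false t by have /andP[] := well_itv false t.
have r20 : 0 < narrowing ^+ 2 by rewrite exprn_gt0.
apply: le_trans (@middle_scale R i N (well false t / narrowing ^+ 2) _ _ _) _.
- by rewrite divr_ge0// ltW.
- by rewrite mulrC divfK// gt_eqF.
rewrite middle_true0//; apply: (@le_trans _ _ (well false t / narrowing ^+ 2)).
  rewrite ler_pdivlMr// mul1r well_false.
  move: t01; rewrite in_itv /= => /andP[t0 t1].
  have t2 : `|t - 1 / 2| <= 1 / 2 by rewrite ler_norml; lra.
  apply: le_trans (sqr_sinpi_ge t2).
  rewrite tE mulrCA exprMn ler_peMr ?(ltW r20)//.
  move: dt; rewrite in_itv /= negb_and -ltNge -leNgt => /orP[dt|dt]; nra.
by rewrite ler_peMl ?lam_ge1// divr_ge0// ltW.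
Qed.

Definition total_mass : \bar R := (\int[@circle_leb R]_x density b s x)%E.
Definition outer_mass : \bar R :=
  (\int[@circle_leb R]_x ((\1_(~` circle_arc 0 delta) x)%:E * density b s x))%E.
Definition profile_mass : \bar R :=
  (\int[lebesgue_measure]_(t in `[0%R, 1%R[) (profile t)%:E)%E.

Let mA : measurable (~` circle_arc 0 delta).
Proof. by apply: measurableC; apply: measurable_circle_arc; exact/ltW/delta_gt0. Qed.

Let mpot : measurable_fun setT (fun t => expR (b * pot s 0 t)).
Proof.
apply: measurableT_comp => //; apply: measurable_funM => //.
by apply: continuous_measurable_fun; exact: continuous_pot.
Qed.

Lemma total_massE : total_mass =
  (\int[lebesgue_measure]_(t in `[0%R, 1%R[) (expR (b * pot s 0 t))%:E)%E.
Proof.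
rewrite /total_mass (ge0_integral_circle (measurable_density b s) (density_ge0 b s)).
by apply: eq_integral => t _; rewrite /density potentialE.
Qed.

(** The factor [narrowing] is the Jacobian of [dil]; it is the entropic disadvantage of the site
    1/2. *)
Lemma outer_mass_le : (outer_mass <= (expR (b * (base + slack)))%:E *
   (1 + narrowing%:E * profile_mass))%E.
Proof.
have mo : measurable_fun setT
    (fun x : T => ((\1_(~` circle_arc 0 delta) x)%:E * density b s x)%E).
  apply: emeasurable_funM; last exact: measurable_density.
  exact/measurable_EFinP/measurable_indic.
have o0 x : (0 <= (\1_(~` circle_arc 0 delta) x)%:E * density b s x)%E.
  by rewrite mule_ge0 ?density_ge0// lee_fin indicE.
rewrite /outer_mass (ge0_integral_circle mo o0).
have [h [h0 mh hE hval]] : exists h : R -> \bar R, [/\ forall t, (0 <= h t)%E,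
    measurable_fun setT h,
    (\int[lebesgue_measure]_(t in `[0%R, 1%R[) h t <= narrowing%:E * profile_mass)%E &
    forall t, h t = (if dil t \in `[0, 1[ then profile (dil t) else 0)%:E].
  pose prof : R -> \bar R := (fun t => (profile t)%:E) \_ `[0%R, 1%R[.
  have prof0 t : (0 <= prof t)%E.
    by rewrite /prof /patch; case: ifP => // _; rewrite lee_fin expR_ge0.
  have mprof : measurable_fun [set: measurableTypeR R] prof.
    apply/(measurable_restrictT _ _).1 => //; apply: measurable_funTS.
    by apply/measurable_EFinP; exact: measurable_profile.
  have mh : measurable_fun [set: measurableTypeR R] (fun t => prof (dil t)).
    apply: measurableT_comp mprof _.
    exact/measurable_funD/measurable_cst/measurable_funM.
  exists (fun t => prof (dil t)); split.
  - by move=> t; exact: prof0.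
  - exact: mh.
  - apply: (@le_trans _ _ (\int[lebesgue_measure]_t prof (dil t))%E).
      exact: (@ge0_subset_integral _ _ _ lebesgue_measure _ _
        (measurable_itv `[0%R, 1%R[) measurableT _ mh (fun t _ => prof0 (dil t)) (@subsetT _ _)).
    have rn0 : narrowing^-1 != 0 by rewrite invr_eq0 gt_eqF.
    rewrite (ge0_integral_affine ((1 - narrowing^-1) / 2) rn0 mprof prof0).
    by rewrite ger0_norm ?invr_ge0 ?(ltW r0)// invrK /profile_mass /prof -integral_mkcond.
  - by move=> t; rewrite /prof /patch mem_setE; case: ifP.
have C0 : 0 <= expR (b * (base + slack)) by exact: expR_ge0.
apply: (@le_trans _ _ (\int[lebesgue_measure]_(t in `[0%R, 1%R[)
   ((expR (b * (base + slack)))%:E * (1 + h t)))%E).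
  apply: ge0_le_integral => //.
  - by apply: measurable_funTS; exact: (measurableT_comp mo (@measurable_to_circle R)).
  - by apply: measurable_funTS; apply: measurable_funeM; apply: emeasurable_funD.
  - move=> t t01; rewrite indicE; case: (boolP (_ \in _)) => [|_]; last first.
      by rewrite mul0e mule_ge0// adde_ge0.
    rewrite inE mul1e /density potentialE => /= tA.
    have := pot_upper_dilated t01 tA; rewrite -lee_fin; move/le_trans; apply.
    by rewrite EFinM lee_wpmul2l ?lee_fin// hval -EFinD.
rewrite ge0_integralZl//; last 2 first.
- by apply: measurable_funTS; apply: emeasurable_funD.
- by move=> t _; rewrite adde_ge0.
rewrite lee_wpmul2l ?lee_fin// ge0_integralD//; last exact: measurable_funTS.
apply: leeD => //; rewrite integral_cst// mul1e.
suff : (lebesgue_measure (`[0%R, 1%R[ : set R) <= 1)%E by [].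
by rewrite lebesgue_measure_itv /= lte01 oppr0 adde0.
Qed.

(** The reflection exchanging 0 and 1/2 brings the profile back to 0. On the wide bump of index [i]
    the density dominates it by [pot_lower]; elsewhere the profile equals 1, which accounts for the
    last summand. *)
Lemma profile_mass_le : ((expR (b * base))%:E * profile_mass <=
  total_mass + (expR (b * base))%:E)%E.
Proof.
pose g (x : T) : \bar R := (profile (csec x))%:E.
have mg : measurable_fun setT g.
  apply/measurable_EFinP; exact: measurableT_comp measurable_profile (@measurable_csec R).
have g0 x : (0 <= g x)%E by rewrite lee_fin expR_ge0.
have -> : profile_mass = (\int[@circle_leb R]_x g x)%E.
  rewrite (ge0_integral_circle mg g0); apply: eq_integral => t _.
  by rewrite /g /profile well_csec.
rewrite -(@ge0_integral_circle_reflection _ (to_circle (1 / 2)) g)//.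
have mgr : measurable_fun setT (fun x : T => g (to_circle (1 / 2) - x)).
  by apply: (measurableT_comp mg); apply: measurable_circleB => //; exact: measurable_cst.
have e0 : (0 <= (expR (b * base))%:E)%E by rewrite lee_fin expR_ge0.
rewrite -ge0_integralZl// -[X in (_ <= _ + X)%E]integral_circle_cst.
rewrite -ge0_integralD//; last 2 first.
- by move=> x _; exact: density_ge0.
- exact: measurable_density.
apply: ge0_le_integral => //.
- by move=> x _; rewrite mule_ge0.
- exact: measurable_funeM.
- by apply: emeasurable_funD => //; exact: measurable_density.
move=> x _; rewrite /g /profile -{1}(csecK x) -to_circleB well_csec.
rewrite -EFinM -EFinD lee_fin -expRD -mulrDr.
have -> : well false (1 / 2 - csec x) = well true (csec x) :> R.
  by rewrite well_false addrAC subrr add0r -[LHS]/(well true _) wellN.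
have [z1|z1] := leP (lam R true i * well true (csec x)) 1.
  apply: ler_wpDr; rewrite ?expR_ge0// ler_expR ler_wpM2l ?(ltW b0)//.
  exact: pot_lower.
by rewrite middle_true0 ?(ltW z1)// addr0 lerDr expR_ge0.
Qed.

(** For [t] up to [delta / 8] the bound [sin (pi * t) <= 4 * t <= delta / 2] gives
    [lam true i * well true t <= 1 / 4], the range where the first bump of the block is at full
    height. *)
Lemma total_mass_ge :
  ((delta / 8)%:E * (expR (b * base) * expR (b * energy R i))%:E <= total_mass)%E.
Proof.
rewrite total_massE.
have d0 : 0 < delta := delta_gt0 R i.
have d1 : delta <= 1 by rewrite invf_le1 ?exprn_gt0// exprn_ege1// ler1n.
have sub : `[0%R, delta / 8]%classic `<=` `[0%R, 1%R[%classic.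
  by move=> t; rewrite /= !in_itv /=; lra.
apply: (@le_trans _ _ (\int[lebesgue_measure]_(t in `[0%R, (delta / 8)%R])
  (expR (b * pot s 0 t))%:E)%E); last first.
  apply: ge0_subset_integral => //.
  exact/measurable_funTS/measurable_EFinP.
rewrite muleC -[(delta / 8)%:E](_ : lebesgue_measure `[0%R, delta / 8] = _); last first.
  by rewrite lebesgue_measure_itv /= lte_fin divr_gt0// oppr0 adde0.
rewrite -integral_cst//; apply: ge0_le_integral => //.
- by move=> t _; rewrite lee_fin mulr_ge0 ?expR_ge0.
- exact/measurable_funTS/measurable_EFinP.
move=> t; rewrite /= in_itv /= => /andP[t0 t8].
have w4 : lam R true i * well true t <= 1 / 4.
  have -> : 1 / 4 = lam R true i * (delta / 2) ^+ 2.
    by rewrite exprMn mulrA lam_delta mul1r exprVn; field.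
  rewrite ler_wpM2l ?(ltW (lam_gt0 _ _ _))//.
  apply: le_trans (@sqr_sinpi_le R t _) _; first by rewrite t0 /=; lra.
  by rewrite ler_sqr ?nnegrE; lra.
rewrite lee_fin -expRD -mulrDr ler_expR ler_wpM2l ?(ltW b0)//.
apply: le_trans (pot_lower iN si _); last by lra.
by rewrite lerD2l middle_true_ge.
Qed.

(** Here [b * energy R i] is at least 2^(i+11). In the exponent, (i+2)^2 pays for [delta], i+4 for
    [narrowing], and 3 for the 8 in [delta / 8]. *)
Lemma expR_energy : expR (- (b * energy R i)) <= 2 ^- ((i + 2) ^ 2 + i + 7).
Proof.
rewrite expRN lef_pV2 ?posrE ?expR_gt0 ?exprn_gt0//.
set k := (_ + 7)%N.
have e2 : 2 <= expR 1 :> R by have := expR_ge1Dx (1 : R); lra.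
apply: (@le_trans _ _ (expR k%:R)).
  by rewrite -[k%:R]mulr1 expRM_natl lerXn2r ?nnegrE ?expR_ge0.
rewrite ler_expR; apply: (@le_trans _ _ (2 ^+ (i + 11))).
  rewrite -natrX ler_nat /k; elim: i => // n IH.
  apply: leq_trans (_ : 2 * ((n + 2) ^ 2 + n + 7) <= _)%N.
    by rewrite !expnS !expn0; nia.
  by rewrite addSn [(2 ^ (n + 11).+1)%N]expnS leq_mul2l IH.
apply: le_trans (ler_wpM2r _ bi); last exact/ltW/energy_gt0.
rewrite /energy ler_pdivlMr ?exprn_gt0// -exprD ler_eXn2l ?ltr1n//.
rewrite !expnS !expn0; nia.
Qed.

Lemma expR_slack : expR (b * slack) <= 2.
Proof.
have bs : b * slack <= 2^-1.
  rewrite /slack mulrCA ler_piMr// ler_pdivrMr ?exprn_gt0// mul1r; exact: bN.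
have := expR_ge1Dx (- (b * slack)); rewrite expRN => le1.
have e0 := expR_gt0 (b * slack).
have : 2^-1 <= (expR (b * slack))^-1 by lra.
by rewrite lef_pV2 ?posrE.
Qed.

Lemma total_mass_fin : exists pr : R, total_mass = pr%:E.
Proof.
have [K sK] := potential_bounded R s.
have t0 : (0 <= total_mass)%E by apply: integral_ge0 => x _; exact: density_ge0.
have : (total_mass <= (expR (b * K))%:E)%E.
  rewrite -(integral_circle_cst (expR (b * K))%:E); apply: ge0_le_integral => //.
  - by move=> x _; exact: density_ge0.
  - exact: measurable_density.
  - move=> x _; rewrite lee_fin ler_expR ler_wpM2l ?(ltW b0)//.
    exact: le_trans (ler_norm _) (sK x).
by move: t0; case: total_mass => [pr| |]//; exists pr.
Qed.

(** Up to the factor 2 of the later scales, the outer mass is at most three terms, each bounded by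
    [narrowing * pr]: the background, the dilated density, and the background of the dilated part.
    This gives [6 * narrowing], while [8 * narrowing] is allowed. *)
Lemma outer_mass_small : (outer_mass <= (2 ^- i.+1)%:E * total_mass)%E.
Proof.
have [pr prE] := total_mass_fin.
have := outer_mass_le; have := profile_mass_le; have := total_mass_ge.
have : (0 <= profile_mass)%E by apply: integral_ge0 => t _; rewrite lee_fin expR_ge0.
rewrite prE mulrDr expRD.
have Eb0 := expR_gt0 (b * base); move: (expR (b * base)) Eb0 => Eb Eb0.
have Ee0 := expR_gt0 (b * energy R i).
case: profile_mass => [q| |]//; last by rewrite gt0_muley ?lte_fin.
rewrite -!EFinM -!EFinD !lee_fin => q0 ge_pr le_q outer_mass_q.
apply: le_trans outer_mass_q _; rewrite lee_fin.
have Eb_le : Eb <= narrowing * pr.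
  have d0 : 0 < delta := delta_gt0 R i.
  have := ler_wpM2l _ ge_pr; move=> /(_ (8 / delta * expR (- (b * energy R i)))).
  rewrite mulr_ge0 ?expR_ge0 ?divr_ge0 ?(ltW d0)// => /(_ isT).
  have -> : 8 / delta * expR (- (b * energy R i)) *
      (delta / 8 * (Eb * expR (b * energy R i))) = Eb.
    by rewrite expRN; field; rewrite !gt_eqF.
  move=> /le_trans; apply.
  apply: ler_wpM2r.
    by apply: le_trans ge_pr; rewrite mulr_ge0 ?divr_ge0 ?mulr_ge0 ?(ltW d0) ?(ltW Eb0) ?(ltW Ee0).
  apply: le_trans (ler_wpM2l _ expR_energy) _; first by rewrite divr_ge0// ltW.
  rewrite /delta /narrowing invrK -mulrA -!exprVn !exprD.
  have E k : 2 ^+ k * 2^-1 ^+ k = 1 :> R by rewrite exprVn divff// expf_neq0.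
  rewrite [X in 8 * X]mulrA [X in 8 * (X * _)]mulrA E mul1r.
  by move: (2^-1 ^+ i) => u; rewrite le_eqVlt; apply/orP; left; apply/eqP; field.
have narrow8 : 8 * narrowing = 2 ^- i.+1.
  rewrite /narrowing -!exprVn exprD [2^-1 ^+ i.+1]exprS.
  by move: (2^-1 ^+ i) => u; field.
rewrite -narrow8.
have pr0 : 0 <= pr by rewrite -(pmulr_rge0 _ r0); exact: le_trans (ltW Eb0) Eb_le.
have rEq : narrowing * (Eb * q) <= narrowing * (pr + Eb) by rewrite ler_wpM2l// ltW.
have rEb : narrowing * Eb <= Eb by rewrite ler_piMl// ltW.
have := ler_wpM2l (_ : 0 <= Eb * (1 + narrowing * q)) expR_slack.
rewrite mulr_ge0 ?(ltW Eb0)//; last by rewrite addr_ge0// mulr_ge0// ltW.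
move=> /(_ isT); rewrite -mulrA [(1 + _) * _]mulrC mulrA => /le_trans; apply.
nra.
Qed.

End concentration_estimate.

(** * From the density to the Gibbs measure *)

Section gibbs_concentration.
Variable R : realType.
Local Notation T := (circle R).

(** The bound on the law of the increment is applied to the complement of [A]; boundedness of the
    potential makes the total mass positive and finite, so that it can be divided out. *)
Lemma gibbs_concentration (b : R) (s : nat -> bool) (A : set T) (e : R)
    (rho : probability (config R) R) :
  gibbs_measure (nn_interaction (fun x => b * potential s x)) rho ->
  measurable A ->
  (\int[@circle_leb R]_x ((\1_(~` A) x)%:E * density b s x) <=
   e%:E * \int[@circle_leb R]_x density b s x)%E ->
  ((1 - e)%:E <= rho (@difference R @^-1` A))%E.
Proof.
move=> gibbs mA small.
have mU : measurable_fun setT (fun x => b * @potential R s x).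
  by apply: measurable_funM => //; exact: measurable_potential.
have [K sK] := potential_bounded R s.
have UK x : `|b * @potential R s x| <= `|b| * K by rewrite normrM ler_wpM2l.
have mAC : measurable (~` A) by exact: measurableC.
have := gibbs_difference_law mU UK gibbs mAC.
have -> : (\int[@circle_leb R]_x (\1_(~` A) x * expR (b * potential s x))%:E =
  \int[@circle_leb R]_x ((\1_(~` A) x)%:E * density b s x))%E.
  by apply: eq_integral => x _; rewrite EFinM.
move=> /le_trans -/(_ _ small).
have [pr pr0 prE] : exists2 pr : R, 0 < pr &
    (\int[@circle_leb R]_x density b s x = pr%:E)%E.
  have up : (\int[@circle_leb R]_x density b s x <= (expR (`|b| * K))%:E)%E.
    rewrite -(integral_circle_cst (expR (`|b| * K))%:E).
    apply: ge0_le_integral => //.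
    - by move=> x _; exact: density_ge0.
    - exact: measurable_density.
    - move=> x _; rewrite lee_fin ler_expR; exact: le_trans (ler_norm _) (UK x).
  have lo : ((expR (- (`|b| * K)))%:E <= \int[@circle_leb R]_x density b s x)%E.
    rewrite -(integral_circle_cst (expR (- (`|b| * K)))%:E).
    apply: ge0_le_integral => //.
    - exact: measurable_density.
    - by move=> x _; rewrite lee_fin ler_expR; have := UK x; rewrite ler_norml => /andP[].
  move: lo up; case: (\int[_]_x _)%E => [pr| |]//.
  by rewrite !lee_fin => lo _; exists pr => //; apply: lt_le_trans lo; exact: expR_gt0.
have mdA : measurable (@difference R @^-1` A).
  by rewrite -[X in measurable X]setTI; exact: measurable_difference.
have -> : @difference R @^-1` (~` A) = ~` (@difference R @^-1` A) by [].
rewrite [X in (X * _)%E](probability_setC rho mdA) prE.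
have : (rho (@difference R @^-1` A) \is a fin_num)%E by exact: fin_num_measure.
case: (rho _) => [r| |]// _.
rewrite -EFinB -!EFinM !lee_fin ler_pM2r//; lra.
Qed.

Lemma potential_reflection (s : nat -> bool) (x : T) :
  potential s (to_circle (1 / 2) - x) = potential (fun j => ~~ s j) x.
Proof.
rewrite -{1}(csecK x) -to_circleB potentialE /potential.
rewrite [1 / 2 - _]addrC [1 / 2]mul1r pot0Dhalf !pot0E.
by congr (sum_series _); apply/funext => j; rewrite !wellN.
Qed.

Lemma to_circle_reflection (d : R) (x : T) :
  circle_arc (1 / 2) d (to_circle (1 / 2) - x) <-> circle_arc 0 d x.
Proof.
split=> -[t + tx]; rewrite /= in_itv /= => /andP[tl tr].
  exists (1 / 2 - t); first by rewrite /= in_itv /=; lra.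
  by rewrite to_circleB tx subKr.
exists (1 / 2 - t); first by rewrite /= in_itv /=; lra.
by rewrite to_circleB tx.
Qed.

(** The reflection [1 / 2 - x] preserves Lebesgue measure, exchanges the arcs around 0 and 1/2 and
    flips all signs, so the case of the sign + applies to the flipped sequence. *)
Lemma outer_mass_small_half (s : nat -> bool) (i N : nat) (b : R) :
  (i < N)%N -> (forall j, (i <= j < N)%N -> ~~ s j) ->
  2 ^+ ((i + 11) ^ 3) <= b -> b <= 2 ^+ ((N + 10) ^ 3) ->
  (\int[@circle_leb R]_x
    ((\1_(~` circle_arc (1 / 2) (delta R i)) x)%:E * density b s x) <=
   (2 ^- i.+1)%:E * \int[@circle_leb R]_x density b s x)%E.
Proof.
move=> iN si bi bN; have := outer_mass_small iN si bi bN; rewrite /outer_mass /total_mass.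
have refl x : density b s (to_circle (1 / 2) - x) =
    density b (fun j => ~~ s j) x.
  by rewrite /density potential_reflection.
have E2 : (\int[@circle_leb R]_x density b s x =
    \int[@circle_leb R]_x density b (fun j => ~~ s j) x)%E.
  rewrite -(@ge0_integral_circle_reflection _ (to_circle (1 / 2)) (density b s)).
  - by apply: eq_integral => x _; rewrite refl.
  - exact: measurable_density.
  - exact: density_ge0.
pose f x := ((\1_(~` circle_arc (1 / 2) (delta R i)) x)%:E * density b s x)%E.
have mf : measurable_fun setT f.
  apply: emeasurable_funM; last exact: measurable_density.
  apply/measurable_EFinP/measurable_indic/measurableC.
  by apply: measurable_circle_arc; exact/ltW/delta_gt0.
have f0 x : (0 <= f x)%E by rewrite mule_ge0 ?density_ge0// lee_fin indicE.
have E1 : (\int[@circle_leb R]_x f x = \int[@circle_leb R]_x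
    ((\1_(~` circle_arc 0 (delta R i)) x)%:E * density b (fun j => ~~ s j) x))%E.
  rewrite -(ge0_integral_circle_reflection (to_circle (1 / 2)) mf f0).
  apply: eq_integral => x _; rewrite /f refl; congr (_%:E * _)%E.
  rewrite !indicE; congr (nat_of_bool _)%:R; apply/idP/idP; rewrite !inE /= => h h'.
    by apply: h; apply/to_circle_reflection.
  by apply: h; apply/to_circle_reflection.
by rewrite E2 -E1.
Qed.

End gibbs_concentration.

Theorem lemmaA (R : realType) :
  exists U : cantor_space -> Cinfty R,
    continuous U /\
    forall (s : cantor_space) (m m' : nat),
      (1 <= m)%N -> (m <= m')%N ->
      (forall i : nat, (m <= i <= m')%N -> sign s i = sign s m) ->
      forall b : R, beta R m <= b <= beta R m' ->
      forall rho : probability (config R) R,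
        gibbs_measure (nn_interaction (fun x => b * U s x)) rho ->
        (sign s m = plus ->
          (1 - 2 ^- m)%:E <= rho (@difference R @^-1` (@to_circle R @`
            `[(- 2 ^- ((m + 1) ^ 2))%R, (2 ^- ((m + 1) ^ 2))%R]%classic)))%E /\
        (sign s m = minus ->
          (1 - 2 ^- m)%:E <= rho (@difference R @^-1` (@to_circle R @`
            `[(1 / 2 - 2 ^- ((m + 1) ^ 2))%R,
              (1 / 2 + 2 ^- ((m + 1) ^ 2))%R]%classic)))%E.
Proof.
exists (@smooth_pot R); split; first exact: continuous_smooth_pot.
(* The scale is [i.+1], so that [sign s i.+1] is [s i], and the inequality between the scales reads
   [i < N]. *)
move=> s [//|i] N _ iN sign_const b /andP[bi bN] rho gibbs.
have s_const j : (i <= j < N)%N -> s j = s i.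
  by move=> ij; exact: (sign_const j.+1).
have bi' : 2 ^+ ((i + 11) ^ 3) <= b by move: bi; rewrite /beta addSnnS.
have dE : 2 ^- ((i.+1 + 1) ^ 2) = delta R i by rewrite /delta addSnnS.
have d0 : 0 <= delta R i := ltW (delta_gt0 R i).
rewrite dE; split=> si.
  have E : @to_circle R @` `[- delta R i, delta R i] = circle_arc 0 (delta R i).
    by rewrite /circle_arc sub0r add0r.
  rewrite E; apply: (gibbs_concentration gibbs).
    exact: measurable_circle_arc.
  by apply: (outer_mass_small iN) => // j ij; rewrite s_const.
apply: (gibbs_concentration gibbs); first exact: measurable_circle_arc.
by apply: (outer_mass_small_half iN) => // j ij; rewrite s_const// -[s i]/(sign s i.+1) si.
Qed.
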